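(* Let $p>1$, $a,b\in\mathbb{R}$, $R\ge 1$, and let $(f,g)\in C_0^2(\mathbb{R})\times C_0^1(\mathbb{R})$ satisfy $\operatorname{supp} f,\ \operatorname{supp} g\subset\{x\in\mathbb{R}:|x|\le R\}$. Then there exist a constant $\varepsilon_1=\varepsilon_1(f,g,p,a,b,R)>0$ and a constant $c>0$ independent of $\varepsilon$ such that for every $0<\varepsilon\le\varepsilon_1$ a classical solution $u\in C^2(\mathbb{R}\times[0,T])$ of the initial value problem $$ \begin{cases} u_{tt}-u_{xx}=\dfrac{|u_t|^p}{\langle t+\langle x\rangle\rangle^{1+a}\langle t-\langle x\rangle\rangle^{1+b}},\\[2mm] u(x,0)=\varepsilon f(x),\quad u_t(x,0)=\varepsilon g(x),\quad x\in\mathbb{R}, \end{cases} $$ exists as long as $T>0$ satisfies $$ T\le \begin{cases} \exp\left(c\,\varepsilon^{-(p-1)}\right) & \text{if } a=0 \text{ and } b\ge -p,\\ \exp\left(c\,\varepsilon^{-p(p-1)}\right) & \text{if } a>0 \text{ and } p(1+a)+b=0,\\ c\,\varepsilon^{-(p-1)/(-a)} & \text{if } a<0 \text{ and } b\ge -p,\\ c\,\varepsilon^{-p(p-1)/(-p(1+a)-b)} & \text{if } p(1+a)+b<0 \text{ and } b<-p, \end{cases} $$ and, in the remaining case $a>0$ and $p(1+a)+b>0$, for every $T<\infty$.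
   Context: For $x\in\mathbb{R}$, $\langle x\rangle:=\sqrt{1+x^2}$. $C_0^k(\mathbb{R})$ denotes the $C^k$ functions with compact support. A classical solution on the time interval $[0,T]$ is a function $u\in C^2(\mathbb{R}\times[0,T])$ satisfying the equation and the initial conditions pointwise. *)

(* Defs.v *)
From Stdlib Require Import Reals Lra.
From Coquelicot Require Import Coquelicot.
Open Scope R_scope.

Definition japanese (x : R) : R := sqrt (1 + x ^ 2).

(* |x|^p for p > 0. Stdlib's [Rpower] cannot be used at x = 0: since [ln 0 = 0],
   [Rpower 0 p = 1]. *)
Definition abs_pow (x p : R) : R :=
  if Req_dec_T x 0 then 0 else Rpower (Rabs x) p.

Definition supp (f : R -> R) : R -> Prop := adherence (fun x => f x <> 0).

Definition Ck (k : nat) (f : R -> R) : Prop :=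
  forall (j : nat) (x : R), (j <= k)%nat ->
    ex_derive_n f j x /\ continuous (Derive_n f j) x.

Definition C0k (k : nat) (f : R -> R) : Prop := Ck k f /\ compact (supp f).

Definition strip (T : R) (z : R * R) : Prop := 0 <= snd z <= T.

Definition continuous_strip (T : R) (w : R -> R -> R) : Prop :=
  continuous_on (strip T) (fun z : R * R => w (fst z) (snd z)).

Definition is_dx (T : R) (w wx : R -> R -> R) : Prop :=
  forall x t : R, 0 <= t <= T -> is_derive (fun y => w y t) x (wx x t).

(* [D_in] takes the limit of difference quotients within [0, T], so the time
   derivative is one-sided at t = 0 and t = T. *)
Definition is_dt (T : R) (w wt : R -> R -> R) : Prop :=
  forall x t : R, 0 <= t <= T ->
    D_in (fun s => w x s) (fun s => wt x s) (fun s => 0 <= s <= T) t.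

Definition C1_strip (T : R) (w wx wt : R -> R -> R) : Prop :=
  continuous_strip T w /\
  is_dx T w wx /\ is_dt T w wt /\
  continuous_strip T wx /\ continuous_strip T wt.

(* For T > 0 the derivative functions are determined by [u] on the strip, so
   passing them as arguments only names them. *)
Definition C2_strip (T : R) (u ux ut uxx uxt utx utt : R -> R -> R) : Prop :=
  C1_strip T u ux ut /\ C1_strip T ux uxx uxt /\ C1_strip T ut utx utt.

Definition classical_solution
    (p a b : R) (u0 u1 : R -> R) (T : R) (u : R -> R -> R) : Prop :=
  exists ux ut uxx uxt utx utt : R -> R -> R,
    C2_strip T u ux ut uxx uxt utx utt /\
    (forall x t : R, 0 <= t <= T ->
       utt x t - uxx x t =
         abs_pow (ut x t) p /
         (Rpower (japanese (t + japanese x)) (1 + a) *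
          Rpower (japanese (t - japanese x)) (1 + b))) /\
    (forall x : R, u x 0 = u0 x /\ ut x 0 = u1 x).

(* The five alternatives are mutually exclusive and exhaust all (a, b) when p > 1. *)
Definition admissible_time (p a b c eps T : R) : Prop :=
  (a = 0 /\ - p <= b /\ T <= exp (c * Rpower eps (- (p - 1)))) \/
  (0 < a /\ p * (1 + a) + b = 0 /\
     T <= exp (c * Rpower eps (- (p * (p - 1))))) \/
  (a < 0 /\ - p <= b /\ T <= c * Rpower eps (- (p - 1) / (- a))) \/
  (p * (1 + a) + b < 0 /\ b < - p /\
     T <= c * Rpower eps (- (p * (p - 1)) / (- p * (1 + a) - b))) \/
  (0 < a /\ 0 < p * (1 + a) + b).

(* Main.v *)
Require Import Defs.
From Stdlib Require Import Reals Lra Lia.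
From Coquelicot Require Import Coquelicot.
Open Scope R_scope.

(** The proof works with the velocity [v = u_t].  The Riemann invariants
    [u_t + u_x] and [u_t - u_x] are constant along the characteristics
    [x + t = const] and [x - t = const] up to the integral of the source
    [F = |v|^p W], where [W] is the weight; so the initial value problem amounts
    to the Volterra equation [v = v0 + duhamel F], in which the free part [v0] has
    size [eps] and lives within distance [r] of the light cone [|x| = t].

    _Regularity._  Replace [|z|^p] by a [C^1] function that agrees with it for
    [|z| <= 1] and is globally Lipschitz ([trunc_pow]).  The modified equation is
    solved on all of [R^2] by Picard iteration ([volterra]), because a point of a
    diamond [|x| + |t| <= L] only sees its own diamond and an exponential weight
    in time turns the iteration into a contraction there.  Its solution is [C^1]
    in [x] ([volterra_C1]), hence [u] is [C^2] ([wave_of_velocity]).  Working on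
    the plane avoids one-sided derivatives.  What remains is the bound [|v| <= 1]
    for [0 <= t <= T], where the modification is then invisible.

    _A priori bound._  Let [m = t - |x| + r + 1] and [M = t + |x| + r + 1] on the
    support [|x| <= t + r], and suppose [W <= C lam M^(-al) m^q] with [al >= 0].
    Put [mu = lam eps^(p-1)] and [sigma = q + 1 - p al].  Every Picard iterate is
    bounded by [phi(m)], where [phi(y) = eps (K1 y^(-N) + K2 mu y^(-al))]
    ([envelope]).  The first term carries the wave near the cone; a large power
    [N] replaces the cut-off.  The second one is what a characteristic collects
    when it crosses the neighbourhood of the opposite branch of the cone:
    [lam eps^p M^(-al)], with [M] comparable to its label there.  On the
    characteristic with label [Z], parametrised by the label [X] of the crossing
    characteristics, the source [phi(m)^p W] is at most a constant times
    [lam eps^p (Z^(-N) X^(-al) + Z^(-al) (X^(-2) + mu^p X^(sigma-1)))]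
    ([source_bound]).  Its integral reproduces [phi(Z)] as soon as
    [mu * int_1^Th X^(-al) dX] and [mu^p * int_1^Th X^(sigma-1) dX] are small, with
    [Th = 2 T + 2 r + 2] ([duhamel_preserves_envelope]).

    _Lifespan._  These two conditions ([small_data_existence]) give all five
    regimes: according to the sign of [1 - al] and of [sigma], the integrals are
    bounded, logarithmic in [T], or powers of [T].  When an exponent of the weight
    is more favourable than needed it is enlarged first; for [a < -1] the weight
    grows in [M], and the growth is put into the factor
    [lam = Th^(-1-a)] so that [al = 0]. *)

(** * Joint continuity and integration along characteristics *)

Definition cont2 (F : R -> R -> R) : Prop :=
  forall x t : R, continuous (fun z : R * R => F (fst z) (snd z)) (x, t).

Lemma cont2_comp {U : UniformSpace} (F : R -> R -> R) (X S : U -> R) (z : U) :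
  cont2 F -> continuous X z -> continuous S z ->
  continuous (fun y => F (X y) (S y)) z.
Proof.
  intros HF HX HS. exact (continuous_comp_2 X S F z HX HS (HF (X z) (S z))).
Qed.

Lemma cont2_pt (F : R -> R -> R) (x t : R) : cont2 F -> continuity_2d_pt F x t.
Proof. intros H. apply continuity_2d_pt_filterlim. exact (H x t). Qed.

Lemma pt_cont2 (F : R -> R -> R) :
  (forall x t, continuity_2d_pt F x t) -> cont2 F.
Proof. intros H x t. apply continuity_2d_pt_filterlim. exact (H x t). Qed.

Lemma cont2_ext (F G : R -> R -> R) :
  (forall x t, F x t = G x t) -> cont2 F -> cont2 G.
Proof.
  intros H HF x t. apply continuous_ext with (fun z : R * R => F (fst z) (snd z)).
  - intros z; apply H.
  - apply HF.
Qed.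

Lemma cont_affine (c d x : R) : continuous (fun y : R => c * y + d) x.
Proof.
  apply (@ex_derive_continuous R_AbsRing R_NormedModule). auto_derive. exact I.
Qed.

(** Heine on a square, for two points in any position. *)
Lemma cont2_uniform (F : R -> R -> R) (L e : R) :
  cont2 F -> 0 < e -> exists d, 0 < d /\
    forall x t y s, Rabs x <= L -> Rabs t <= L -> Rabs y <= L -> Rabs s <= L ->
      Rabs (y - x) < d -> Rabs (s - t) < d -> Rabs (F y s - F x t) < e.
Proof.
  intros HF He.
  destruct (uniform_continuity_2d F (- L) L (- L) L) with (eps := mkposreal e He)
    as [d Hd].
  { intros; apply cont2_pt; exact HF. }
  exists d; split; [apply cond_pos|].
  intros x t y s Hx Ht Hy Hs Hyx Hst.
  apply Hd; try assumption; now apply Rabs_le_between.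
Qed.

Lemma cont2_bounded (F : R -> R -> R) (L : R) :
  cont2 F -> exists B, 0 <= B /\
    forall x t, Rabs x <= L -> Rabs t <= L -> Rabs (F x t) <= B.
Proof.
  intros HF.
  destruct (cont2_uniform F L 1 HF Rlt_0_1) as [d [Hd H]].
  assert (Hex : exists n, 0 < INR n /\ L / d < INR n).
  { destruct (nfloor_ex (Rmax 0 (L / d))) as [n0 [_ Hn0]]; [apply Rmax_l|].
    exists (S n0). split; [apply lt_0_INR; lia|]. rewrite S_INR.
    eapply Rle_lt_trans; [apply Rmax_r|exact Hn0]. }
  destruct Hex as [n [Hn1 Hn]].
  exists (Rabs (F 0 0) + INR n). split.
  { pose proof (Rabs_pos (F 0 0)); lra. }
  intros x t Hx Ht.
  assert (HLn : L / INR n < d).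
  { apply (Rmult_lt_reg_r (INR n)); [exact Hn1|].
    replace (L / INR n * INR n) with L by (field; lra).
    apply (Rmult_lt_reg_r (/ d)); [now apply Rinv_0_lt_compat|].
    replace (d * INR n * / d) with (INR n) by (field; lra). exact Hn. }
  (* walk from the origin to (x, t) in n steps, each shorter than d *)
  assert (Hw : forall k, (k <= n)%nat ->
     Rabs (F (INR k / INR n * x) (INR k / INR n * t)) <= Rabs (F 0 0) + INR k).
  { induction k as [|k IH]; intros Hk.
    - change (INR 0) with 0. replace (0 / INR n) with 0 by (unfold Rdiv; ring).
      rewrite !Rmult_0_l. lra.
    - assert (Hk' : (k <= n)%nat) by lia. specialize (IH Hk').
      assert (Hfr : forall j, (j <= n)%nat -> 0 <= INR j / INR n <= 1).
      { intros j Hj. split.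
        - apply Rdiv_le_0_compat; [apply pos_INR|exact Hn1].
        - apply Rle_div_l; [exact Hn1|]. rewrite Rmult_1_l. now apply le_INR. }
      assert (Hin : forall j z, (j <= n)%nat -> Rabs z <= L ->
                     Rabs (INR j / INR n * z) <= L).
      { intros j z Hj Hz. rewrite Rabs_mult, (Rabs_right (INR j / INR n)).
        - pose proof (Hfr j Hj). pose proof (Rabs_pos z). nra.
        - apply Rle_ge, Hfr; exact Hj. }
      assert (Hst : forall z, Rabs z <= L ->
                Rabs (INR (S k) / INR n * z - INR k / INR n * z) < d).
      { intros z Hz. replace (INR (S k) / INR n * z - INR k / INR n * z)
          with (z / INR n) by (rewrite S_INR; field; lra).
        unfold Rdiv. rewrite Rabs_mult, (Rabs_right (/ INR n)).
        - eapply Rle_lt_trans; [|exact HLn]. apply Rmult_le_compat_r; [|exact Hz].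
          left; now apply Rinv_0_lt_compat.
        - left; now apply Rinv_0_lt_compat. }
      pose proof (H _ _ _ _ (Hin k x Hk' Hx) (Hin k t Hk' Ht)
         (Hin (S k) x Hk Hx) (Hin (S k) t Hk Ht) (Hst x Hx) (Hst t Ht)) as HH.
      rewrite S_INR in *.
      apply Rabs_def2 in HH. apply Rabs_le_between in IH.
      apply Rabs_le_between. lra. }
  specialize (Hw n (Nat.le_refl n)).
  replace (INR n / INR n) with 1 in Hw by (field; lra).
  rewrite !Rmult_1_l in Hw. exact Hw.
Qed.

Lemma ex_RInt_cont (h : R -> R) (a b : R) :
  (forall s, continuous h s) -> ex_RInt h a b.
Proof. intros H. apply (@ex_RInt_continuous R_CompleteNormedModule). intros; apply H. Qed.

Lemma RInt_bound (h : R -> R) (a b M : R) :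
  ex_RInt h a b -> (forall s, Rmin a b <= s <= Rmax a b -> Rabs (h s) <= M) ->
  Rabs (RInt h a b) <= M * Rabs (b - a).
Proof.
  intros Hex HM. destruct (Rle_dec a b) as [Hab|Hab].
  - rewrite Rmin_left, Rmax_right in HM by lra.
    rewrite (Rabs_right (b - a)) by lra. rewrite Rmult_comm.
    now apply abs_RInt_le_const.
  - rewrite Rmin_right, Rmax_left in HM by lra.
    rewrite <- (opp_RInt_swap h b a) by now apply ex_RInt_swap.
    rewrite (Rabs_left (b - a)) by lra. change (Rabs (- RInt h b a) <= M * - (b - a)).
    rewrite Rabs_Ropp. replace (M * - (b - a)) with ((a - b) * M) by ring.
    apply abs_RInt_le_const; [lra|now apply ex_RInt_swap|exact HM].
Qed.

(** The integral of [F] from time [0] to [t] along the line of speed [- c] that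
    ends in [(x, t)]: [c = 1] and [c = -1] give the two families of
    characteristics, [c = 0] the time integral that recovers [u] from [u_t]. *)
Definition char_int (c : R) (F : R -> R -> R) (x t : R) : R :=
  RInt (fun s => F (x + c * (t - s)) s) 0 t.

Lemma char_int_integrand_cont (c : R) (F : R -> R -> R) (x t s : R) :
  cont2 F -> continuous (fun s => F (x + c * (t - s)) s) s.
Proof.
  intros HF. apply (cont2_comp F); [exact HF| |apply continuous_id].
  apply continuous_ext with (fun s => - c * s + (x + c * t)).
  - intros y; simpl; ring.
  - apply cont_affine.
Qed.

Lemma char_int_ex (c : R) (F : R -> R -> R) (x t a b : R) :
  cont2 F -> ex_RInt (fun s => F (x + c * (t - s)) s) a b.
Proof. intros HF. apply ex_RInt_cont. intros s. now apply char_int_integrand_cont. Qed.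

Lemma Rabs_between (s t : R) : Rmin 0 t <= s <= Rmax 0 t -> Rabs s <= Rabs t.
Proof.
  unfold Rmin, Rmax. destruct (Rle_dec 0 t); unfold Rabs; repeat destruct Rcase_abs; lra.
Qed.

(** Moving the end point changes the path, which uniform continuity of [F]
    controls, and lengthens it, which the bound on [F] controls. *)
Lemma cont2_char_int (c : R) (F : R -> R -> R) : cont2 F -> cont2 (char_int c F).
Proof.
  intros HF. apply pt_cont2. intros x t [e He].
  set (L := Rabs x + 1 + Rabs c * (2 * Rabs t + 2) + Rabs t + 1).
  destruct (cont2_bounded F L HF) as [B [HB0 HB]].
  assert (He1 : 0 < e / (2 * (Rabs t + 1))).
  { apply Rdiv_lt_0_compat; [exact He|]. pose proof (Rabs_pos t); lra. }
  destruct (cont2_uniform F L _ HF He1) as [d [Hd Hu]].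
  assert (Hc1 : 0 < 1 + Rabs c) by (pose proof (Rabs_pos c); lra).
  assert (Hdelta : 0 < Rmin (Rmin 1 (d / (1 + Rabs c))) (e / (2 * (B + 1)))).
  { repeat apply Rmin_pos; try lra; apply Rdiv_lt_0_compat; lra. }
  exists (mkposreal _ Hdelta). simpl. intros x' t' Hx' Ht'.
  assert (Hx1 : Rabs (x' - x) < 1).
  { eapply Rlt_le_trans; [exact Hx'|]. eapply Rle_trans; [apply Rmin_l|apply Rmin_l]. }
  assert (Ht1 : Rabs (t' - t) < 1).
  { eapply Rlt_le_trans; [exact Ht'|]. eapply Rle_trans; [apply Rmin_l|apply Rmin_l]. }
  assert (Hxd : Rabs (x' - x) < d / (1 + Rabs c)).
  { eapply Rlt_le_trans; [exact Hx'|]. eapply Rle_trans; [apply Rmin_l|apply Rmin_r]. }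
  assert (Htd : Rabs (t' - t) < d / (1 + Rabs c)).
  { eapply Rlt_le_trans; [exact Ht'|]. eapply Rle_trans; [apply Rmin_l|apply Rmin_r]. }
  assert (Hte : Rabs (t' - t) < e / (2 * (B + 1))).
  { eapply Rlt_le_trans; [exact Ht'|]. apply Rmin_r. }
  assert (Ht'1 : Rabs t' <= Rabs t + 1).
  { replace t' with (t + (t' - t)) by ring. eapply Rle_trans; [apply Rabs_triang|lra]. }
  assert (Hx'1 : Rabs x' <= Rabs x + 1).
  { replace x' with (x + (x' - x)) by ring. eapply Rle_trans; [apply Rabs_triang|lra]. }
  assert (Hin : forall y r s, Rabs y <= Rabs x + 1 -> Rabs r <= Rabs t + 1 ->
     Rabs s <= Rabs t + 1 -> Rabs (y + c * (r - s)) <= L /\ Rabs s <= L).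
  { intros y r s Hy Hr Hs. unfold L.
    pose proof (Rabs_pos c). pose proof (Rabs_pos x). pose proof (Rabs_pos t). split; [|nra].
    eapply Rle_trans; [apply Rabs_triang|]. rewrite Rabs_mult.
    assert (Rabs (r - s) <= 2 * Rabs t + 2).
    { unfold Rminus. eapply Rle_trans; [apply Rabs_triang|]. rewrite Rabs_Ropp. lra. }
    nra. }
  assert (Heq : char_int c F x' t' - char_int c F x t =
     RInt (fun s => F (x' + c * (t' - s)) s - F (x + c * (t - s)) s) 0 t
     + RInt (fun s => F (x' + c * (t' - s)) s) t t').
  { unfold char_int.
    assert (HC : RInt (fun s => F (x' + c * (t' - s)) s) 0 t
        + RInt (fun s => F (x' + c * (t' - s)) s) t t'
        = RInt (fun s => F (x' + c * (t' - s)) s) 0 t')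
      by (apply (RInt_Chasles (fun s => F (x' + c * (t' - s)) s)); now apply char_int_ex).
    assert (Hm : RInt (fun s => F (x' + c * (t' - s)) s - F (x + c * (t - s)) s) 0 t
        = RInt (fun s => F (x' + c * (t' - s)) s) 0 t - RInt (fun s => F (x + c * (t - s)) s) 0 t)
      by (apply (RInt_minus (fun s => F (x' + c * (t' - s)) s)); now apply char_int_ex).
    rewrite Hm, <- HC. ring. }
  rewrite Heq. eapply Rle_lt_trans; [apply Rabs_triang|].
  assert (H1 : Rabs (RInt (fun s => F (x' + c * (t' - s)) s - F (x + c * (t - s)) s) 0 t)
     <= e / (2 * (Rabs t + 1)) * Rabs (t - 0)).
  { apply RInt_bound.
    - apply (@ex_RInt_minus R_NormedModule); now apply char_int_ex.
    - intros s Hs. apply Rabs_between in Hs. left.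
      destruct (Hin x' t' s) as [h1 h2]; try lra.
      destruct (Hin x t s) as [h3 h4]; try lra.
      apply Hu; try assumption.
      + replace (x' + c * (t' - s) - (x + c * (t - s))) with ((x' - x) + c * (t' - t)) by ring.
        eapply Rle_lt_trans; [apply Rabs_triang|]. rewrite Rabs_mult.
        apply Rlt_le_trans with ((1 + Rabs c) * (d / (1 + Rabs c))); [|right; field; lra].
        pose proof (Rabs_pos c). nra.
      + rewrite Rminus_diag, Rabs_R0. exact Hd. }
  assert (H2 : Rabs (RInt (fun s => F (x' + c * (t' - s)) s) t t') <= B * Rabs (t' - t)).
  { apply RInt_bound; [now apply char_int_ex|].
    intros s Hs.
    assert (Rabs s <= Rabs t + 1).
    { revert Hs. unfold Rmin, Rmax. revert Ht1. 
      destruct (Rle_dec t t'); unfold Rabs; repeat destruct Rcase_abs; lra. }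
    destruct (Hin x' t' s) as [h1 h2]; try lra. now apply HB. }
  rewrite Rminus_0_r in H1.
  assert (H3 : e / (2 * (Rabs t + 1)) * Rabs t < e / 2).
  { pose proof (Rabs_pos t). apply Rlt_le_trans with (e / (2 * (Rabs t + 1)) * (Rabs t + 1)).
    - apply Rmult_lt_compat_l; lra.
    - right; field; lra. }
  assert (H4 : B * Rabs (t' - t) <= e / 2).
  { apply Rle_trans with ((B + 1) * (e / (2 * (B + 1)))); [|right; field; lra].
    pose proof (Rabs_pos (t' - t)). nra. }
  lra.
Qed.

(** The gain [1 / k] is what makes the integral operators below contractions
    in the norm weighted by [exp (k |t|)]. *)
Lemma exp_weight_RInt_pos (h : R -> R) (t k C : R) :
  0 < k -> 0 <= C -> (forall s, continuous h s) -> 0 <= t ->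
  (forall s, 0 <= s <= t -> Rabs (h s) <= C * exp (k * s)) ->
  Rabs (RInt h 0 t) <= C / k * exp (k * t).
Proof.
  intros Hk HC Hc Ht Hb.
  assert (HI : is_RInt (fun s => C * exp (k * s)) 0 t (minus (C / k * exp (k * t)) (C / k * exp (k * 0)))).
  { apply (is_RInt_derive (fun s => C / k * exp (k * s)) (fun s => C * exp (k * s))).
    - intros s _. auto_derive; [exact I|field; lra].
    - intros s _. apply (@ex_derive_continuous R_AbsRing R_NormedModule). auto_derive. exact I. }
  assert (H : norm (RInt h 0 t) <= minus (C / k * exp (k * t)) (C / k * exp (k * 0))).
  { eapply norm_RInt_le; [exact Ht|exact Hb| |exact HI].
    apply (@RInt_correct R_CompleteNormedModule). now apply ex_RInt_cont. }
  unfold norm, minus, plus, opp in H; simpl in H. unfold abs in H; simpl in H.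
  assert (0 <= C / k * exp (k * 0)).
  { apply Rmult_le_pos; [apply Rdiv_le_0_compat; assumption|left; apply exp_pos]. }
  lra.
Qed.

Lemma exp_weight_RInt (h : R -> R) (t k C : R) :
  0 < k -> 0 <= C -> (forall s, continuous h s) ->
  (forall s, Rmin 0 t <= s <= Rmax 0 t -> Rabs (h s) <= C * exp (k * Rabs s)) ->
  Rabs (RInt h 0 t) <= C / k * exp (k * Rabs t).
Proof.
  intros Hk HC Hc Hb. destruct (Rle_dec 0 t) as [Ht|Ht].
  - rewrite Rmin_left, Rmax_right in Hb by lra. rewrite (Rabs_right t) by lra.
    apply exp_weight_RInt_pos; try assumption.
    intros s Hs. rewrite <- (Rabs_right s) at 2 by lra. now apply Hb.
  - rewrite Rmin_right, Rmax_left in Hb by lra. rewrite (Rabs_left t) by lra.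
    assert (Hcn : forall s, continuous (fun s => h (-1 * s + 0)) s).
    { intros s. apply (continuous_comp (fun s => -1 * s + 0) h); [apply cont_affine|apply Hc]. }
    assert (Hr : - RInt (fun s => h (-1 * s + 0)) 0 (- t) = RInt h 0 t).
    { assert (Hl : RInt (fun s => -1 * h (-1 * s + 0)) 0 (- t) = RInt h (-1 * 0 + 0) (-1 * - t + 0))
        by (apply (RInt_comp_lin h (-1) 0 0 (- t)); now apply ex_RInt_cont).
      replace (-1 * 0 + 0) with 0 in Hl by ring. replace (-1 * - t + 0) with t in Hl by ring.
      rewrite <- Hl.
      symmetry. transitivity (-1 * RInt (fun s => h (-1 * s + 0)) 0 (- t)); [|ring].
      apply (RInt_scal (fun s => h (-1 * s + 0))). now apply ex_RInt_cont. }
    rewrite <- Hr.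
    rewrite Rabs_Ropp. apply exp_weight_RInt_pos; try assumption; [lra|].
    intros s Hs. replace (k * s) with (k * Rabs (-1 * s + 0)).
    + apply Hb; lra.
    + rewrite Rabs_left1; [ring|lra].
Qed.

(** A domain of dependence for both time directions: the characteristics from a
    point of the diamond back to time [0] do not leave it. *)
Definition diamond (L x t : R) : Prop := Rabs x + Rabs t <= L.

Lemma diamond_back (L c x t s : R) :
  Rabs c <= 1 -> diamond L x t -> Rmin 0 t <= s <= Rmax 0 t ->
  diamond L (x + c * (t - s)) s.
Proof.
  unfold diamond. intros Hc HL Hs.
  assert (H : Rabs (t - s) + Rabs s = Rabs t).
  { revert Hs. unfold Rmin, Rmax. destruct (Rle_dec 0 t); unfold Rabs;
      repeat destruct Rcase_abs; lra. }
  pose proof (Rabs_triang x (c * (t - s))) as Htr. rewrite Rabs_mult in Htr.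
  pose proof (Rabs_pos (t - s)). nra.
Qed.

Lemma char_int_weight (L c k C : R) (E : R -> R -> R) :
  Rabs c <= 1 -> 0 < k -> 0 <= C -> cont2 E ->
  (forall x t, diamond L x t -> Rabs (E x t) <= C * exp (k * Rabs t)) ->
  forall x t, diamond L x t -> Rabs (char_int c E x t) <= C / k * exp (k * Rabs t).
Proof.
  intros Hc Hk HC HE Hb x t Hxt. unfold char_int.
  apply (exp_weight_RInt (fun s => E (x + c * (t - s)) s)); try assumption.
  - intros s. now apply char_int_integrand_cont.
  - intros s Hs. apply Hb. now apply diamond_back.
Qed.

Lemma char_int_minus (c : R) (F G : R -> R -> R) (x t : R) :
  cont2 F -> cont2 G ->
  char_int c (fun x t => F x t - G x t) x t = char_int c F x t - char_int c G x t.
Proof.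
  intros HF HG.
  exact (RInt_minus (fun s => F (x + c * (t - s)) s) (fun s => G (x + c * (t - s)) s)
      0 t (char_int_ex c F x t 0 t HF) (char_int_ex c G x t 0 t HG)).
Qed.

Lemma char_int_scal (c k : R) (F : R -> R -> R) (x t : R) :
  cont2 F ->
  char_int c (fun x t => k * F x t) x t = k * char_int c F x t.
Proof.
  intros HF.
  exact (RInt_scal (fun s => F (x + c * (t - s)) s) 0 t k (char_int_ex c F x t 0 t HF)).
Qed.

Lemma cont2_plus (F G : R -> R -> R) :
  cont2 F -> cont2 G -> cont2 (fun x t => F x t + G x t).
Proof. intros HF HG x t. apply (@continuous_plus _ R_AbsRing R_NormedModule); [apply HF|apply HG]. Qed.

Lemma cont2_minus (F G : R -> R -> R) :
  cont2 F -> cont2 G -> cont2 (fun x t => F x t - G x t).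
Proof. intros HF HG x t. apply (@continuous_minus _ R_AbsRing R_NormedModule); [apply HF|apply HG]. Qed.

Lemma cont2_mult (F G : R -> R -> R) :
  cont2 F -> cont2 G -> cont2 (fun x t => F x t * G x t).
Proof. intros HF HG x t. apply (@continuous_mult _ R_AbsRing); [apply HF|apply HG]. Qed.

Lemma cont2_scal (k : R) (F : R -> R -> R) :
  cont2 F -> cont2 (fun x t => k * F x t).
Proof. intros HF. apply (cont2_mult (fun _ _ => k)); [intros x t; apply continuous_const|exact HF]. Qed.

Lemma cont2_app (h : R -> R) (F : R -> R -> R) :
  (forall z, continuous h z) -> cont2 F -> cont2 (fun x t => h (F x t)).
Proof.
  intros Hh HF x t. apply (continuous_comp (fun z : R * R => F (fst z) (snd z)) h);
  [apply HF|apply Hh].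
Qed.

Lemma cont2_fst : cont2 (fun x t => x).
Proof. intros x t. apply continuous_fst. Qed.
Lemma cont2_snd : cont2 (fun x t => t).
Proof. intros x t. apply continuous_snd. Qed.

(** Differentiation under the integral sign. *)
Lemma char_int_dx (c : R) (F Fx : R -> R -> R) (x t : R) :
  cont2 F -> cont2 Fx -> (forall x t, is_derive (fun y => F y t) x (Fx x t)) ->
  is_derive (fun y => char_int c F y t) x (char_int c Fx x t).
Proof.
  intros HF HFx Hd. unfold char_int.
  assert (Hd' : forall y s, is_derive (fun u => F (u + c * (t - s)) s) y (Fx (y + c * (t - s)) s)).
  { intros y s. 
    assert (H := is_derive_comp (fun u => F u s) (fun u => u + c * (t - s)) y _ 1 (Hd _ s)).
    cbv beta in H. rewrite <- (Rmult_1_l (Fx _ _)). apply H. auto_derive; [exact I|ring]. }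
  rewrite (RInt_ext (fun s => Fx (x + c * (t - s)) s)
     (fun s => Derive (fun u => F (u + c * (t - s)) s) x)).
  2:{ intros s _. symmetry. apply is_derive_unique, Hd'. }
  apply is_derive_RInt_param.
  - apply filter_forall. intros y s _. eexists; apply Hd'.
  - intros s _. apply (continuity_2d_pt_ext (fun u v => Fx (u + c * (t - v)) v)).
    + intros u v. symmetry. apply is_derive_unique, Hd'.
    + apply cont2_pt. intros u v. apply (cont2_comp Fx); [exact HFx| |apply continuous_snd].
      apply (cont2_plus (fun u v => u) (fun u v => c * (t - v))); [apply cont2_fst|].
      apply cont2_scal, (cont2_minus (fun _ _ => t)); [|apply cont2_snd].
      intros ? ?; apply continuous_const.
  - apply filter_forall. intros y. now apply char_int_ex.
Qed.

(** The upper limit contributes [F x t]; the motion of the line with [t]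
    contributes the integral of [c * Fx]. *)
Lemma char_int_dt (c : R) (F Fx : R -> R -> R) (x t : R) :
  cont2 F -> cont2 Fx -> (forall x t, is_derive (fun y => F y t) x (Fx x t)) ->
  is_derive (fun s => char_int c F x s) t (F x t + c * char_int c Fx x t).
Proof.
  intros HF HFx Hd. unfold char_int.
  assert (Hd' : forall r s, is_derive (fun u => F (x + c * (u - s)) s) r (c * Fx (x + c * (r - s)) s)).
  { intros r s. 
    assert (H := is_derive_comp (fun u => F u s) (fun u => x + c * (u - s)) r _ c (Hd _ s)).
    cbv beta in H. apply H. auto_derive; [exact I|ring]. }
  assert (HD : cont2 (fun u v => Derive (fun z => F (x + c * (z - v)) v) u)).
  { apply (cont2_ext (fun u v => c * Fx (x + c * (u - v)) v)).
    - intros u v. symmetry. apply is_derive_unique, Hd'.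
    - apply cont2_scal. intros u v. apply (cont2_comp Fx); [exact HFx| |apply continuous_snd].
      apply (cont2_plus (fun u v => x) (fun u v => c * (u - v))).
      + intros ? ?; apply continuous_const.
      + apply cont2_scal, cont2_minus; [apply cont2_fst|apply cont2_snd]. }
  assert (HI : c * RInt (fun s => Fx (x + c * (t - s)) s) 0 t =
     RInt (fun s => Derive (fun u => F (x + c * (u - s)) s) t) 0 t).
  { transitivity (RInt (fun s => c * Fx (x + c * (t - s)) s) 0 t).
    - symmetry. exact (RInt_scal _ 0 t c (char_int_ex c Fx x t 0 t HFx)).
    - apply RInt_ext. intros s _. symmetry. apply is_derive_unique, Hd'. }
  rewrite HI.
  replace (F x t + RInt (fun s => Derive (fun u => F (x + c * (u - s)) s) t) 0 t)
    with (RInt (fun s => Derive (fun u => F (x + c * (u - s)) s) t) 0 t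
      + - F (x + c * (t - 0)) 0 * 0 + F (x + c * (t - t)) t * 1).
  2:{ replace (x + c * (t - t)) with x by ring. ring. }
  apply (is_derive_RInt_param_bound_comp (fun u s => F (x + c * (u - s)) s) (fun _ => 0) (fun r => r)).
  - apply filter_forall. intros; now apply char_int_ex.
  - exists (mkposreal 1 Rlt_0_1). apply filter_forall. intros; now apply char_int_ex.
  - exists (mkposreal 1 Rlt_0_1). apply filter_forall. intros; now apply char_int_ex.
  - apply (@is_derive_const R_AbsRing R_NormedModule).
  - apply (@is_derive_id R_AbsRing).
  - exists (mkposreal 1 Rlt_0_1). apply filter_forall. intros y s _. eexists; apply Hd'.
  - intros s _. apply cont2_pt, HD.
  - exists (mkposreal 1 Rlt_0_1). intros; apply cont2_pt, HD.
  - exists (mkposreal 1 Rlt_0_1). intros; apply cont2_pt, HD.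
  - apply continuity_pt_filterlim. apply (char_int_integrand_cont c F x t 0 HF).
  - apply continuity_pt_filterlim. apply (char_int_integrand_cont c F x t t HF).
Qed.

(** * Volterra equations along characteristics *)

(** The contribution of a source [F] to the velocity [u_t]. *)
Definition duhamel (F : R -> R -> R) (x t : R) : R :=
  (char_int 1 F x t + char_int (-1) F x t) / 2.

Lemma cont2_duhamel (F : R -> R -> R) : cont2 F -> cont2 (duhamel F).
Proof.
  intros HF. apply (cont2_ext (fun x t => / 2 * (char_int 1 F x t + char_int (-1) F x t))).
  - intros x t. unfold duhamel. field.
  - apply cont2_scal, cont2_plus; now apply cont2_char_int.
Qed.

Lemma duhamel_minus (F G : R -> R -> R) (x t : R) :
  cont2 F -> cont2 G ->
  duhamel (fun x t => F x t - G x t) x t = duhamel F x t - duhamel G x t.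
Proof. intros HF HG. unfold duhamel. rewrite !char_int_minus by assumption. field. Qed.

Lemma duhamel_scal (k : R) (F : R -> R -> R) (x t : R) :
  cont2 F -> duhamel (fun x t => k * F x t) x t = k * duhamel F x t.
Proof. intros HF. unfold duhamel. rewrite !char_int_scal by assumption. field. Qed.

Lemma duhamel_weight (L k C : R) (E : R -> R -> R) :
  0 < k -> 0 <= C -> cont2 E ->
  (forall x t, diamond L x t -> Rabs (E x t) <= C * exp (k * Rabs t)) ->
  forall x t, diamond L x t -> Rabs (duhamel E x t) <= C / k * exp (k * Rabs t).
Proof.
  intros Hk HC HE Hb x t Hxt.
  assert (H1 := char_int_weight L 1 k C E).
  assert (H2 := char_int_weight L (-1) k C E).
  rewrite Rabs_right in H1 by lra. rewrite Rabs_left in H2 by lra.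
  specialize (H1 ltac:(lra) Hk HC HE Hb x t Hxt).
  specialize (H2 ltac:(lra) Hk HC HE Hb x t Hxt).
  unfold duhamel. apply Rabs_le_between in H1. apply Rabs_le_between in H2.
  apply Rabs_le_between. lra.
Qed.

Lemma le_of_halving (y A B : R) :
  0 <= A -> (forall n, y <= A * (1 / 2) ^ n + B) -> y <= B.
Proof.
  intros HA H.
  assert (Hl : is_lim_seq (fun n => A * (1 / 2) ^ n + B) (A * 0 + B)).
  { apply (is_lim_seq_plus' (fun n => A * (1 / 2) ^ n) (fun _ => B)).
    - apply (is_lim_seq_scal_l (fun n => (1 / 2) ^ n) A 0).
      apply is_lim_seq_geom. rewrite Rabs_right; lra.
    - apply is_lim_seq_const. }
  assert (H1 := is_lim_seq_le (fun _ => y) _ y (A * 0 + B) H (is_lim_seq_const y) Hl).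
  simpl in H1. lra.
Qed.

Lemma halving_small (A e : R) : 0 <= A -> 0 < e -> exists n, A * (1 / 2) ^ n < e.
Proof.
  intros HA He.
  assert (Hl : is_lim_seq (fun n => A * (1 / 2) ^ n) (A * 0)).
  { apply (is_lim_seq_scal_l (fun n => (1 / 2) ^ n) A 0).
    apply is_lim_seq_geom. rewrite Rabs_right; lra. }
  apply is_lim_seq_spec in Hl. destruct (Hl (mkposreal e He)) as [N HN].
  exists N. specialize (HN N (Nat.le_refl N)). simpl in HN.
  apply Rabs_def2 in HN. lra.
Qed.

Lemma halving_limit (u : nat -> R) (C : R) :
  (forall n, Rabs (u (S n) - u n) <= C * (1 / 2) ^ n) ->
  is_lim_seq u (real (Lim_seq u)) /\
  forall n, Rabs (u n - real (Lim_seq u)) <= 2 * C * (1 / 2) ^ n.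
Proof.
  intros H.
  assert (HC : 0 <= C).
  { specialize (H 0%nat). simpl in H. pose proof (Rabs_pos (u 1%nat - u 0%nat)). lra. }
  assert (Hp : forall n, 0 < (1 / 2) ^ n) by (intros; apply pow_lt; lra).
  assert (Hmn : forall n k, Rabs (u (n + k)%nat - u n) <= 2 * C * (1 / 2) ^ n).
  { intros n k.
    assert (Hk : Rabs (u (n + k)%nat - u n) <= 2 * C * (1 / 2) ^ n * (1 - (1 / 2) ^ k)).
    { induction k as [|k IH].
      - rewrite Nat.add_0_r, Rminus_diag, Rabs_R0. simpl. lra.
      - rewrite Nat.add_succ_r. specialize (H (n + k)%nat). rewrite pow_add in H.
        simpl. apply Rabs_le_between in H. apply Rabs_le_between in IH.
        apply Rabs_le_between. lra. }
    specialize (Hp k). pose proof (Rlt_le _ _ (pow_lt (1/2) n ltac:(lra))).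
    assert (0 <= C * (1/2)^n) by now apply Rmult_le_pos. nra. }
  assert (Hex : ex_finite_lim_seq u).
  { apply ex_lim_seq_cauchy_corr. intros [e He].
    destruct (halving_small (4 * C) e) as [N HN]; [lra|exact He|].
    exists N. intros n m Hn Hm. simpl.
    pose proof (Hmn N (n - N)%nat) as h1. pose proof (Hmn N (m - N)%nat) as h2.
    replace (N + (n - N))%nat with n in h1 by lia.
    replace (N + (m - N))%nat with m in h2 by lia.
    apply Rabs_le_between in h1. apply Rabs_le_between in h2.
    apply Rabs_def1; lra. }
  assert (Hlim : is_lim_seq u (real (Lim_seq u))) by now apply Lim_seq_correct'.
  split; [exact Hlim|]. intros n.
  assert (Hl2 : is_lim_seq (fun k => u (n + k)%nat) (real (Lim_seq u))).
  { apply is_lim_seq_ext with (fun k => u (k + n)%nat).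
    - intros k. now rewrite Nat.add_comm.
    - now apply is_lim_seq_incr_n. }
  assert (Hl3 := is_lim_seq_minus' _ _ _ _ Hl2 (is_lim_seq_const (u n))).
  apply (is_lim_seq_abs _ (real (Lim_seq u) - u n)) in Hl3.
  rewrite Rabs_minus_sym.
  exact (is_lim_seq_le _ (fun _ => 2 * C * (1 / 2) ^ n) _ _ (Hmn n) Hl3 (is_lim_seq_const _)).
Qed.

Lemma exp_mono (x y : R) : x <= y -> exp x <= exp y.
Proof. intros [H|H]; [left; now apply exp_increasing|subst; lra]. Qed.

Fixpoint picard (v0 : R -> R -> R) (G : R -> R -> R -> R) (n : nat) : R -> R -> R :=
  match n with
  | O => fun _ _ => 0
  | S n => fun x t => v0 x t + duhamel (fun x t => G x t (picard v0 G n x t)) x t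
  end.

Definition cont_comp (G : R -> R -> R -> R) : Prop :=
  forall v, cont2 v -> cont2 (fun x t => G x t (v x t)).

(** Only local uniformity in [(x, t)] is asked for, because the weight may grow
    in [x]; uniformity in the unknown makes the solution global. *)
Definition loc_lipschitz (G : R -> R -> R -> R) : Prop :=
  forall L, exists k, 0 < k /\ forall x t y z, diamond L x t ->
    Rabs (G x t y - G x t z) <= k * Rabs (y - z).

Lemma cont2_picard (v0 : R -> R -> R) (G : R -> R -> R -> R) (n : nat) :
  cont2 v0 -> cont_comp G -> cont2 (picard v0 G n).
Proof.
  intros H0 HG. induction n as [|n IH]; simpl.
  - intros x t. apply continuous_const.
  - apply cont2_plus; [exact H0|]. now apply cont2_duhamel, HG.
Qed.

Lemma diamond_coord (L x t : R) : diamond L x t -> Rabs x <= L /\ Rabs t <= L.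
Proof. unfold diamond. pose proof (Rabs_pos x). pose proof (Rabs_pos t). lra. Qed.

(** On a diamond the iteration contracts by [1 / 2] in the norm weighted by
    [exp (2 k |t|)], where [k] is the Lipschitz constant. *)
Lemma picard_step (v0 : R -> R -> R) (G : R -> R -> R -> R) (L : R) :
  cont2 v0 -> cont_comp G -> loc_lipschitz G ->
  exists C, 0 <= C /\ forall n x t, diamond L x t ->
    Rabs (picard v0 G (S n) x t - picard v0 G n x t) <= C * (1 / 2) ^ n.
Proof.
  intros H0 HG HL. destruct (HL L) as [k [Hk Hlip]].
  destruct (cont2_bounded (picard v0 G 1) L) as [B [HB0 HB]]; [now apply cont2_picard|].
  assert (Hw : forall n x t, diamond L x t ->
    Rabs (picard v0 G (S n) x t - picard v0 G n x t)
      <= B * (1 / 2) ^ n * exp (2 * k * Rabs t)).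
  { induction n as [|n IH]; intros x t Hxt.
    - change (picard v0 G 0 x t) with 0. rewrite Rminus_0_r.
      destruct (diamond_coord L x t Hxt) as [h1 h2].
      eapply Rle_trans; [now apply HB|]. rewrite pow_O, Rmult_1_r.
      rewrite <- (Rmult_1_r B) at 1. apply Rmult_le_compat_l; [exact HB0|].
      rewrite <- exp_0. apply exp_mono. pose proof (Rabs_pos t). nra.
    - set (E := fun x t => G x t (picard v0 G (S n) x t) - G x t (picard v0 G n x t)).
      assert (HcE : cont2 E) by (apply cont2_minus; apply HG; now apply cont2_picard).
      replace (picard v0 G (S (S n)) x t - picard v0 G (S n) x t) with (duhamel E x t).
      2:{ unfold E. rewrite duhamel_minus by (apply HG; now apply cont2_picard).
          simpl. ring. }
      replace (B * (1 / 2) ^ S n) with (k * (B * (1 / 2) ^ n) / (2 * k)) by (simpl; field; lra).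
      apply (duhamel_weight L (2 * k)); [lra| |exact HcE| |exact Hxt].
      + apply Rmult_le_pos; [lra|]. apply Rmult_le_pos; [exact HB0|apply pow_le; lra].
      + intros y s Hys. unfold E. eapply Rle_trans; [now apply Hlip|].
        rewrite Rmult_assoc. apply Rmult_le_compat_l; [lra|]. now apply IH. }
  exists (B * exp (2 * k * L)). split.
  { apply Rmult_le_pos; [exact HB0|left; apply exp_pos]. }
  intros n x t Hxt. eapply Rle_trans; [now apply Hw|].
  rewrite Rmult_assoc, (Rmult_comm _ (exp _)), <- Rmult_assoc.
  apply Rmult_le_compat_r; [apply pow_le; lra|]. apply Rmult_le_compat_l; [exact HB0|].
  apply diamond_coord in Hxt. destruct Hxt as [_ h].
  apply exp_mono. nra.
Qed.

(** The solution is returned together with the iterates, since bounds that are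
    stable under the iteration pass to it through this limit. *)
Theorem volterra (v0 : R -> R -> R) (G : R -> R -> R -> R) :
  cont2 v0 -> cont_comp G -> loc_lipschitz G ->
  exists v, cont2 v /\
    (forall x t, v x t = v0 x t + duhamel (fun x t => G x t (v x t)) x t) /\
    (forall x t, is_lim_seq (fun n => picard v0 G n x t) (v x t)).
Proof.
  intros H0 HG HL.
  set (v := fun x t => real (Lim_seq (fun n => picard v0 G n x t))).
  assert (Hu : forall L, exists C, 0 <= C /\ forall n x t, diamond L x t ->
     Rabs (picard v0 G n x t - v x t) <= C * (1 / 2) ^ n).
  { intros L. destruct (picard_step v0 G L H0 HG HL) as [C [HC H]].
    exists (2 * C). split; [lra|]. intros n x t Hxt.
    apply (halving_limit (fun n => picard v0 G n x t) C). intros m. now apply H. }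
  assert (Hv : cont2 v).
  { apply pt_cont2. intros x t [e He].
    destruct (Hu (Rabs x + Rabs t + 2)) as [C [HC H]].
    destruct (halving_small C (e / 3)) as [n Hn]; [exact HC|lra|].
    assert (Hpc := cont2_pt _ x t (cont2_picard v0 G n H0 HG)).
    assert (He3 : 0 < e / 3) by lra.
    destruct (Hpc (mkposreal _ He3)) as [d Hd]. simpl in Hd.
    assert (Hd1 : 0 < Rmin 1 d) by (apply Rmin_pos; [lra|apply cond_pos]).
    exists (mkposreal _ Hd1). simpl. intros y s Hy Hs.
    assert (Hy1 := Rlt_le_trans _ _ _ Hy (Rmin_l _ _)).
    assert (Hs1 := Rlt_le_trans _ _ _ Hs (Rmin_l _ _)).
    specialize (Hd y s (Rlt_le_trans _ _ _ Hy (Rmin_r _ _)) (Rlt_le_trans _ _ _ Hs (Rmin_r _ _))).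
    assert (h1 : Rabs (picard v0 G n x t - v x t) <= C * (1 / 2) ^ n).
    { apply H. unfold diamond. lra. }
    assert (h2 : Rabs (picard v0 G n y s - v y s) <= C * (1 / 2) ^ n).
    { apply H. unfold diamond.
      replace y with (x + (y - x)) by ring. replace s with (t + (s - t)) by ring.
      pose proof (Rabs_triang x (y - x)). pose proof (Rabs_triang t (s - t)). lra. }
    apply Rabs_def2 in Hd. apply Rabs_le_between in h1. apply Rabs_le_between in h2.
    apply Rabs_def1; lra. }
  exists v. split; [exact Hv|]. split.
  - intros x t. set (L := Rabs x + Rabs t).
    assert (Hxt : diamond L x t) by (unfold diamond, L; lra).
    destruct (Hu L) as [C [HC H]]. destruct (HL L) as [k [Hk Hlip]].
    apply Rminus_diag_uniq.
    assert (Hz : Rabs (v x t - (v0 x t + duhamel (fun x t => G x t (v x t)) x t)) <= 0).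
    { apply (le_of_halving _ (C + C * exp (k * Rabs t))).
      { pose proof (exp_pos (k * Rabs t)). nra. }
      intros n. rewrite Rplus_0_r.
      set (E := fun x t => G x t (picard v0 G n x t) - G x t (v x t)).
      assert (Hpn : cont2 (picard v0 G n)) by now apply cont2_picard.
      assert (HcE : cont2 E) by (apply cont2_minus; apply HG; assumption).
      replace (v x t - (v0 x t + duhamel (fun x t => G x t (v x t)) x t))
        with (duhamel E x t - (picard v0 G (S n) x t - v x t)).
      2:{ unfold E. rewrite duhamel_minus by (apply HG; assumption).
          simpl. ring. }
      assert (h1 : Rabs (picard v0 G (S n) x t - v x t) <= C * (1 / 2) ^ n).
      { eapply Rle_trans; [now apply H|]. simpl.
        pose proof (pow_lt (1 / 2) n ltac:(lra)).
        assert (0 <= C * (1 / 2) ^ n) by (apply Rmult_le_pos; lra). lra. }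
      assert (h2 : Rabs (duhamel E x t) <= k * (C * (1 / 2) ^ n) / k * exp (k * Rabs t)).
      { assert (Hp : 0 <= C * (1 / 2) ^ n) by (apply Rmult_le_pos; [exact HC|apply pow_le; lra]).
        apply (duhamel_weight L k); try assumption.
        - apply Rmult_le_pos; lra.
        - intros y s Hys. unfold E. eapply Rle_trans; [now apply Hlip|].
          eapply Rle_trans; [apply Rmult_le_compat_l; [lra|now apply H]|].
          rewrite <- (Rmult_1_r (k * _)) at 1. apply Rmult_le_compat_l; [nra|].
          pose proof (exp_ineq1_le (k * Rabs s)). pose proof (Rabs_pos s). nra. }
      replace (k * (C * (1 / 2) ^ n) / k) with (C * (1 / 2) ^ n) in h2 by (field; lra).
      apply Rabs_le_between in h1. apply Rabs_le_between in h2.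
      apply Rabs_le_between. lra. }
    apply Rabs_le_between in Hz. lra.
  - intros x t. destruct (picard_step v0 G (Rabs x + Rabs t) H0 HG HL) as [C [HC H]].
    apply (halving_limit (fun n => picard v0 G n x t) C). intros n. apply H.
    unfold diamond; lra.
Qed.

(** Iterating the two inequalities halves the a priori bound [S0] each time, in
    the norm weighted by [exp (2 k |t|)], and only the multiple of [e] survives. *)
Lemma gronwall (L k e S0 : R) (D E : R -> R -> R) :
  1 <= k -> 0 <= e -> 0 <= S0 -> cont2 E ->
  (forall x t, diamond L x t -> Rabs (D x t) <= S0) ->
  (forall x t, diamond L x t -> Rabs (E x t) <= k * Rabs (D x t) + e) ->
  (forall x t, diamond L x t -> Rabs (D x t) <= e + Rabs (duhamel E x t)) ->
  forall x t, diamond L x t -> Rabs (D x t) <= 4 * e * exp (2 * k * L).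
Proof.
  intros Hk He HS HE HD0 HED HDE.
  assert (Hexp : forall t, 1 <= exp (2 * k * Rabs t)).
  { intros t. pose proof (exp_ineq1_le (2 * k * Rabs t)). pose proof (Rabs_pos t). nra. }
  assert (Hn : forall n x t, diamond L x t ->
    Rabs (D x t) <= (S0 * (1 / 2) ^ n + 4 * e) * exp (2 * k * Rabs t)).
  { induction n as [|n IH]; intros x t Hxt.
    - specialize (HD0 x t Hxt). specialize (Hexp t). rewrite pow_O. nra.
    - eapply Rle_trans; [now apply HDE|].
      set (S := S0 * (1 / 2) ^ n) in *.
      assert (HSn : 0 <= S) by (apply Rmult_le_pos; [exact HS|apply pow_le; lra]).
      assert (h : Rabs (duhamel E x t) <= (k * (S + 4 * e) + e) / (2 * k) * exp (2 * k * Rabs t)).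
      { apply (duhamel_weight L (2 * k)); [lra|nra|exact HE| |exact Hxt].
        intros y s Hys. specialize (HED y s Hys). specialize (IH y s Hys).
        specialize (Hexp s). nra. }
      replace ((k * (S + 4 * e) + e) / (2 * k)) with (S / 2 + 2 * e + e / (2 * k)) in h
        by (field; lra).
      assert (he : e / (2 * k) <= e).
      { apply Rle_div_l; [lra|]. nra. }
      replace (S0 * (1 / 2) ^ Datatypes.S n) with (S / 2) by (unfold S; simpl; field).
      specialize (Hexp t). nra. }
  intros x t Hxt.
  apply (le_of_halving _ (S0 * exp (2 * k * L))).
  { apply Rmult_le_pos; [exact HS|left; apply exp_pos]. }
  intros n. eapply Rle_trans; [now apply (Hn n)|].
  apply diamond_coord in Hxt. destruct Hxt as [_ h].
  assert (hx : exp (2 * k * Rabs t) <= exp (2 * k * L)).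
  { apply exp_mono. nra. }
  assert (0 <= (1 / 2) ^ n) by (apply pow_le; lra).
  assert (0 <= S0 * (1 / 2) ^ n) by now apply Rmult_le_pos.
  nra.
Qed.

(** * Differentiability in space of solutions of a Volterra equation *)

Lemma mean_value (h dh : R -> R) (a b : R) :
  (forall z, is_derive h z (dh z)) ->
  exists c, Rmin a b <= c <= Rmax a b /\ h b - h a = dh c * (b - a).
Proof.
  intros H. apply MVT_gen; intros z _; [apply H|].
  apply continuity_pt_filterlim, (@ex_derive_continuous R_AbsRing R_NormedModule).
  eexists; apply H.
Qed.

Lemma Rabs_mid (a b c : R) :
  Rmin a b <= c <= Rmax a b -> Rabs (c - a) <= Rabs (b - a).
Proof.
  unfold Rmin, Rmax. destruct (Rle_dec a b); unfold Rabs; repeat destruct Rcase_abs; lra.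
Qed.

Lemma char_int_shift (c h : R) (F : R -> R -> R) (x t : R) :
  char_int c (fun x t => F (x + h) t) x t = char_int c F (x + h) t.
Proof. apply RInt_ext. intros s _. f_equal. ring. Qed.

Lemma duhamel_shift (h : R) (F : R -> R -> R) (x t : R) :
  duhamel (fun x t => F (x + h) t) x t = duhamel F (x + h) t.
Proof. unfold duhamel. now rewrite !char_int_shift. Qed.

Lemma cont2_shift (h : R) (F : R -> R -> R) :
  cont2 F -> cont2 (fun x t => F (x + h) t).
Proof.
  intros HF x t. apply (cont2_comp F); [exact HF| |apply continuous_snd].
  apply (cont2_plus (fun x t => x) (fun _ _ => h)); [apply cont2_fst|].
  intros ? ?; apply continuous_const.
Qed.

Definition C1x (F Fx : R -> R -> R) : Prop :=
  cont2 F /\ cont2 Fx /\ forall x t, is_derive (fun y => F y t) x (Fx x t).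

(** The mean value theorem and the uniform continuity of [Fx]. *)
Lemma C1x_taylor (F Fx : R -> R -> R) (L e : R) :
  C1x F Fx -> 0 < e -> exists d, 0 < d /\ forall x t h,
    Rabs x <= L -> Rabs t <= L -> Rabs h < d ->
    Rabs (F (x + h) t - F x t - h * Fx x t) <= e * Rabs h.
Proof.
  intros [_ [HFx Hd]] He.
  destruct (cont2_uniform Fx (L + 1) e HFx He) as [d [Hd0 Hu]].
  exists (Rmin 1 d). split; [apply Rmin_pos; lra|].
  intros x t h Hx Ht Hh.
  assert (Hh1 := Rlt_le_trans _ _ _ Hh (Rmin_l _ _)).
  assert (Hh2 := Rlt_le_trans _ _ _ Hh (Rmin_r _ _)).
  destruct (mean_value (fun y => F y t) (fun y => Fx y t) x (x + h)) as [c [Hc Heq]].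
  { intros z; apply Hd. }
  apply Rabs_mid in Hc. rewrite Heq.
  replace (x + h - x) with h in * by ring.
  replace (Fx c t * h - h * Fx x t) with ((Fx c t - Fx x t) * h) by ring.
  rewrite Rabs_mult. apply Rmult_le_compat_r; [apply Rabs_pos|]. left.
  assert (Rabs c <= L + 1).
  { replace c with (x + (c - x)) by ring. pose proof (Rabs_triang x (c - x)). lra. }
  apply Hu; try lra. rewrite Rminus_diag, Rabs_R0. exact Hd0.
Qed.

Lemma cont2_derive_comp (n : R -> R) (v W : R -> R -> R) :
  (forall z, continuous n z) -> cont2 v -> cont2 W ->
  cont2 (fun x t => n (v x t) * W x t).
Proof. intros Hn Hv HW. apply cont2_mult; [now apply cont2_app|exact HW]. Qed.

(** Formal differentiation in [x] gives a linear Volterra equation, whose solution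
    [w] is the candidate for the derivative.  The remainder
    [v (x + h) t - v x t - h * w x t] satisfies a Gronwall inequality with an error
    that is [o(h)], hence is itself [o(h)].  Since
    [n] is only continuous (for [p < 2] the derivative of the power is not locally
    Lipschitz), the differentiated Picard iteration need not contract; the linear
    equation for [w], with [v] already known, does. *)
Theorem volterra_C1 (N n : R -> R) (Lam : R) (W Wx v0 v0x v : R -> R -> R) :
  (forall z, is_derive N z (n z)) -> (forall z, continuous n z) ->
  0 <= Lam -> (forall z, Rabs (n z) <= Lam) ->
  C1x W Wx -> C1x v0 v0x -> cont2 v ->
  (forall x t, v x t = v0 x t + duhamel (fun x t => N (v x t) * W x t) x t) ->
  exists w, C1x v w.
Proof.
  intros HN Hn HLam HnL [HW [HWx HdW]] [Hv0 [Hv0x Hdv0]] Hv Heq.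
  assert (HcN : forall z, continuous N z).
  { intros z. apply (@ex_derive_continuous R_AbsRing R_NormedModule). eexists; apply HN. }
  set (G := fun x t z => n (v x t) * W x t * z + N (v x t) * Wx x t).
  assert (HnW : cont2 (fun x t => n (v x t) * W x t)) by now apply cont2_derive_comp.
  assert (HNWx : cont2 (fun x t => N (v x t) * Wx x t)) by now apply cont2_derive_comp.
  assert (HNW : cont2 (fun x t => N (v x t) * W x t)) by now apply cont2_derive_comp.
  assert (HG : cont_comp G).
  { intros w Hw. unfold G. apply cont2_plus; [|exact HNWx]. now apply cont2_mult. }
  assert (HL : loc_lipschitz G).
  { intros L. destruct (cont2_bounded _ L HnW) as [B [HB0 HB]].
    exists (B + 1). split; [lra|]. intros x t y z Hxt.
    apply diamond_coord in Hxt. specialize (HB x t (proj1 Hxt) (proj2 Hxt)).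
    unfold G. match goal with |- Rabs ?q <= _ =>
      replace q with (n (v x t) * W x t * (y - z)) by ring end.
    rewrite Rabs_mult. apply Rmult_le_compat_r; [apply Rabs_pos|lra]. }
  destruct (volterra v0x G Hv0x HG HL) as [w [Hw [Hweq _]]].
  exists w. split; [exact Hv|]. split; [exact Hw|]. intros x0 t0.
  set (L := Rabs x0 + Rabs t0). 
  destruct (cont2_bounded _ (L + 1) HW) as [B1 [HB10 HB1]].
  destruct (cont2_bounded _ (L + 1) Hw) as [B2 [HB20 HB2]].
  destruct (cont2_bounded (fun x t => N (v x t)) (L + 1)) as [B3 [HB30 HB3]].
  { now apply cont2_app. }
  destruct (cont2_bounded _ (L + 1) Hv) as [B4 [HB40 HB4]].
  set (B := B1 + B2 + B3).
  set (k := B * Lam + Lam + 1). set (K := B * B + B + Lam * B + 1).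
  assert (HB : 0 <= B) by (unfold B; lra).
  assert (Hk : 1 <= k) by (unfold k; pose proof (Rmult_le_pos _ _ HB HLam); lra).
  assert (HK : 1 <= K).
  { unfold K. pose proof (Rmult_le_pos _ _ HLam HB). pose proof (Rmult_le_pos _ _ HB HB). lra. }
  apply is_derive_Reals. intros e He.
  set (Z := 8 * K * exp (2 * k * L)).
  assert (HZ : 0 < Z) by (unfold Z; pose proof (exp_pos (2 * k * L)); nra).
  set (eta := Rmin 1 (e / Z)).
  assert (Heta : 0 < eta).
  { apply Rmin_pos; [lra|]. now apply Rdiv_lt_0_compat. }
  assert (Heta1 : eta <= 1) by apply Rmin_l.
  assert (HetaZ : eta * Z <= e).
  { apply Rle_trans with (e / Z * Z); [|right; field; lra].
    apply Rmult_le_compat_r; [lra|apply Rmin_r]. }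
  destruct (cont2_uniform (fun z _ => n z) B4 eta) as [dn [Hdn Hun]].
  { apply (cont2_app n (fun x t => x)); [exact Hn|apply cont2_fst]. } { exact Heta. }
  destruct (cont2_uniform v (L + 1) dn Hv Hdn) as [dv [Hdv Huv]].
  destruct (cont2_uniform W (L + 1) eta HW Heta) as [dW [HdW0 HuW]].
  destruct (C1x_taylor W Wx L eta) as [dT [HdT HuT]]; [now split|exact Heta|].
  destruct (C1x_taylor v0 v0x L eta) as [d0 [Hd0 Hu0]]; [now split|exact Heta|].
  assert (Hdel : 0 < Rmin (Rmin 1 dv) (Rmin dW (Rmin dT d0))).
  { repeat apply Rmin_pos; lra. }
  exists (mkposreal _ Hdel). simpl. intros h Hh0 Hh.
  assert (Hh1 : Rabs h < 1).
  { eapply Rlt_le_trans; [exact Hh|]. eapply Rle_trans; [apply Rmin_l|apply Rmin_l]. }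
  assert (Hhv : Rabs h < dv).
  { eapply Rlt_le_trans; [exact Hh|]. eapply Rle_trans; [apply Rmin_l|apply Rmin_r]. }
  assert (HhW : Rabs h < dW).
  { eapply Rlt_le_trans; [exact Hh|]. eapply Rle_trans; [apply Rmin_r|apply Rmin_l]. }
  assert (HhT : Rabs h < dT).
  { eapply Rlt_le_trans; [exact Hh|]. eapply Rle_trans; [apply Rmin_r|].
    eapply Rle_trans; [apply Rmin_r|apply Rmin_l]. }
  assert (Hh00 : Rabs h < d0).
  { eapply Rlt_le_trans; [exact Hh|]. eapply Rle_trans; [apply Rmin_r|].
    eapply Rle_trans; [apply Rmin_r|apply Rmin_r]. }
  clear Hh. pose proof (Rabs_pos_lt h Hh0) as Hhp.
  set (D := fun x t => v (x + h) t - v x t - h * w x t).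
  set (E := fun x t => N (v (x + h) t) * W (x + h) t - N (v x t) * W x t
              - h * (n (v x t) * W x t * w x t + N (v x t) * Wx x t)).
  assert (HGw : cont2 (fun x t => n (v x t) * W x t * w x t + N (v x t) * Wx x t)).
  { apply (HG w Hw). }
  assert (HNWs := cont2_shift h _ HNW).
  assert (HcE : cont2 E).
  { unfold E. apply cont2_minus; [apply cont2_minus; assumption|now apply cont2_scal]. }
  assert (HcD : cont2 D).
  { unfold D. apply cont2_minus; [apply cont2_minus; [now apply cont2_shift|assumption]|now apply cont2_scal]. }
  destruct (cont2_bounded D L HcD) as [S0 [HS0 HS]].
  assert (HD : Rabs (D x0 t0) <= 4 * (eta * K * Rabs h) * exp (2 * k * L)).
  { apply (gronwall L k (eta * K * Rabs h) S0 D E); try assumption.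
    - apply Rmult_le_pos; [apply Rmult_le_pos|]; lra.
    - intros x t Hxt. apply diamond_coord in Hxt. now apply HS.
    - intros x t Hxt. apply diamond_coord in Hxt. destruct Hxt as [Hx Ht].
      assert (Hxh : Rabs (x + h) <= L + 1).
      { pose proof (Rabs_triang x h). lra. }
      specialize (HuT x t h Hx Ht HhT).
      assert (q1 : Rabs (W x t) <= B) by (unfold B; specialize (HB1 x t ltac:(lra) ltac:(lra)); lra).
      assert (q2 : Rabs (w x t) <= B) by (unfold B; specialize (HB2 x t ltac:(lra) ltac:(lra)); lra).
      assert (q3 : Rabs (N (v x t)) <= B) by (unfold B; specialize (HB3 x t ltac:(lra) ltac:(lra)); lra).
      assert (q4 := HB4 x t ltac:(lra) ltac:(lra)).
      assert (q5 := HB4 (x + h) t ltac:(lra) ltac:(lra)).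
      assert (qW : Rabs (W (x + h) t - W x t) <= eta).
      { left. apply HuW; try lra; [now replace (x + h - x) with h by ring|].
        rewrite Rminus_diag, Rabs_R0. exact HdW0. }
      assert (qv : Rabs (v (x + h) t - v x t) < dn).
      { apply Huv; try lra; [now replace (x + h - x) with h by ring|].
        rewrite Rminus_diag, Rabs_R0. exact Hdv. }
      destruct (mean_value N n (v x t) (v (x + h) t) HN) as [c [Hc HNc]].
      assert (Hcb : Rabs c <= B4).
      { revert Hc q4 q5. clear. unfold Rmin, Rmax.
        destruct (Rle_dec (v x t) (v (x + h) t)); unfold Rabs; repeat destruct Rcase_abs; lra. }
      apply Rabs_mid in Hc.
      assert (qn : Rabs (n c - n (v x t)) <= eta).
      { left. apply (Hun (v x t) 0 c 0); try lra; try (rewrite Rabs_R0; exact HB40).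
        rewrite Rminus_diag, Rabs_R0. exact Hdn. }
      assert (Hdec : E x t = W x t * (n c * D x t + (n c - n (v x t)) * (h * w x t))
          + N (v x t) * (W (x + h) t - W x t - h * Wx x t)
          + n c * (D x t + h * w x t) * (W (x + h) t - W x t)).
      { unfold E, D. replace (N (v (x + h) t)) with (N (v x t) + n c * (v (x + h) t - v x t)) by lra.
        ring. }
      assert (qnc := HnL c). rewrite Hdec.
      pose proof (Rabs_pos (D x t)) as p1.
      assert (T0 : Rabs (h * w x t) <= Rabs h * B).
      { rewrite Rabs_mult. apply Rmult_le_compat_l; lra. }
      assert (T1 : Rabs (W x t * (n c * D x t + (n c - n (v x t)) * (h * w x t)))
         <= B * (Lam * Rabs (D x t) + eta * (Rabs h * B))).
      { rewrite Rabs_mult. apply Rmult_le_compat; try apply Rabs_pos; [exact q1|].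
        eapply Rle_trans; [apply Rabs_triang|]. rewrite (Rabs_mult (n c)), (Rabs_mult (n c - _)).
        apply Rplus_le_compat; apply Rmult_le_compat; try apply Rabs_pos; lra. }
      assert (T2 : Rabs (N (v x t) * (W (x + h) t - W x t - h * Wx x t)) <= B * (eta * Rabs h)).
      { rewrite Rabs_mult. apply Rmult_le_compat; try apply Rabs_pos; lra. }
      assert (T3 : Rabs (n c * (D x t + h * w x t) * (W (x + h) t - W x t))
         <= Lam * (Rabs (D x t) + Rabs h * B) * eta).
      { rewrite !Rabs_mult. apply Rmult_le_compat; try apply Rabs_pos; [| |exact qW].
        - apply Rmult_le_pos; apply Rabs_pos.
        - apply Rmult_le_compat; try apply Rabs_pos; [lra|].
          eapply Rle_trans; [apply Rabs_triang|lra]. }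
      eapply Rle_trans; [apply Rabs_triang|].
      eapply Rle_trans; [apply Rplus_le_compat_r, Rabs_triang|].
      assert (T4 : Lam * Rabs (D x t) * eta <= Lam * Rabs (D x t)).
      { rewrite <- (Rmult_1_r (Lam * Rabs (D x t))) at 2. apply Rmult_le_compat_l; [|lra].
        now apply Rmult_le_pos. }
      assert (0 <= eta * Rabs h) by (apply Rmult_le_pos; lra).
      unfold k, K. lra.
    - intros x t Hxt.
      assert (HDE : D x t = (v0 (x + h) t - v0 x t - h * v0x x t) + duhamel E x t).
      { unfold E. rewrite duhamel_minus, duhamel_minus, duhamel_scal; try assumption.
        2: now apply cont2_minus. 2: now apply cont2_scal.
        rewrite (duhamel_shift h (fun x t => N (v x t) * W x t)).
        unfold D. rewrite (Heq (x + h) t), (Heq x t), (Hweq x t). unfold G. ring. }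
      apply diamond_coord in Hxt. destruct Hxt as [Hx Ht].
      specialize (Hu0 x t h Hx Ht Hh00). rewrite HDE.
      eapply Rle_trans; [apply Rabs_triang|]. apply Rplus_le_compat_r.
      assert (0 <= eta * Rabs h) by (apply Rmult_le_pos; lra). nra.
    - unfold diamond, L. lra. }
  replace ((v (x0 + h) t0 - v x0 t0) / h - w x0 t0) with (D x0 t0 / h) by (unfold D; field; exact Hh0).
  unfold Rdiv. rewrite Rabs_mult, Rabs_inv.
  apply (Rmult_lt_reg_r (Rabs h)); [exact Hhp|].
  rewrite Rmult_assoc, Rinv_l, Rmult_1_r by lra.
  eapply Rle_lt_trans; [exact HD|].
  unfold Z in HetaZ.
  apply Rle_lt_trans with (e / 2 * Rabs h); [|nra].
  replace (4 * (eta * K * Rabs h) * exp (2 * k * L))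
    with (eta * (8 * K * exp (2 * k * L)) / 2 * Rabs h) by field.
  apply Rmult_le_compat_r; lra.
Qed.

(** * From the velocity to a classical solution *)

Lemma cont2_strip (T : R) (w : R -> R -> R) : cont2 w -> continuous_strip T w.
Proof.
  intros H [x t] _. intros P HP. specialize (H x t P HP). unfold filtermap in *.
  unfold within. revert H. apply filter_imp. intros y Hy _. exact Hy.
Qed.

Lemma C1_strip_of_plane (T : R) (w wx wt : R -> R -> R) :
  cont2 w -> cont2 wx -> cont2 wt ->
  (forall x t, is_derive (fun y => w y t) x (wx x t)) ->
  (forall x t, is_derive (fun s => w x s) t (wt x t)) ->
  C1_strip T w wx wt.
Proof.
  intros Hw Hwx Hwt Hx Ht.
  split; [now apply cont2_strip|]. split; [intros x t _; apply Hx|].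
  split; [|split; now apply cont2_strip].
  intros x t _. apply D_in_imp with no_cond; [now intros|].
  apply derivable_pt_lim_D_in. apply is_derive_Reals, Ht.
Qed.

Lemma char_int_at_0 (c : R) (F : R -> R -> R) (x : R) : char_int c F x 0 = 0.
Proof. apply (RInt_point 0 (fun s => F (x + c * (0 - s)) s)). Qed.

(** A superposition of a wave to the left and a wave to the right; the velocity
    and the slope of a free solution both have this form. *)
Definition dalembert (k l : R -> R) (x t : R) : R := (k (x + t) + l (x - t)) / 2.

Lemma is_derive_dalembert_x (k l dk dl : R -> R) (x t : R) :
  (forall z, is_derive k z (dk z)) -> (forall z, is_derive l z (dl z)) ->
  is_derive (fun y => dalembert k l y t) x (dalembert dk dl x t).
Proof.
  intros Hk Hl. unfold dalembert.
  auto_derive.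
  - split; [eexists; apply Hk|]. split; [eexists; apply Hl|exact I].
  - rewrite (is_derive_unique _ _ _ (Hk _)), (is_derive_unique _ _ _ (Hl _)). unfold Rminus. field.
Qed.

Lemma is_derive_dalembert_t (k l dk dl : R -> R) (x t : R) :
  (forall z, is_derive k z (dk z)) -> (forall z, is_derive l z (dl z)) ->
  is_derive (fun s => dalembert k l x s) t (dalembert dk (fun z => - dl z) x t).
Proof.
  intros Hk Hl. unfold dalembert.
  auto_derive.
  - split; [eexists; apply Hk|]. split; [eexists; apply Hl|exact I].
  - rewrite (is_derive_unique _ _ _ (Hk _)), (is_derive_unique _ _ _ (Hl _)). unfold Rminus. field.
Qed.

Lemma cont2_dalembert (k l : R -> R) :
  (forall z, continuous k z) -> (forall z, continuous l z) -> cont2 (dalembert k l).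
Proof.
  intros Hk Hl. apply (cont2_ext (fun x t => / 2 * (k (x + t) + l (x - t)))).
  { intros; unfold dalembert; field. }
  apply cont2_scal, cont2_plus.
  - apply (cont2_app k (fun x t => x + t)); [exact Hk|]. apply cont2_plus; [apply cont2_fst|apply cont2_snd].
  - apply (cont2_app l (fun x t => x - t)); [exact Hl|]. apply cont2_minus; [apply cont2_fst|apply cont2_snd].
Qed.

Lemma C1_continuous (k dk : R -> R) :
  (forall z, is_derive k z (dk z)) -> forall z, continuous k z.
Proof.
  intros H z. apply (@ex_derive_continuous R_AbsRing R_NormedModule). eexists; apply H.
Qed.

Lemma C1x_dalembert (k l dk dl : R -> R) :
  (forall z, is_derive k z (dk z)) -> (forall z, is_derive l z (dl z)) ->
  (forall z, continuous dk z) -> (forall z, continuous dl z) ->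
  C1x (dalembert k l) (dalembert dk dl).
Proof.
  intros Hk Hl Hdk Hdl. split; [|split].
  - apply cont2_dalembert; eapply C1_continuous; first [exact Hk|exact Hl|exact Hlo|exact Hu0].
  - now apply cont2_dalembert.
  - intros x t. now apply is_derive_dalembert_x.
Qed.

Lemma is_derive_half_plus (h g : R -> R) (x dh dg : R) :
  is_derive h x dh -> is_derive g x dg -> is_derive (fun y => (h y + g y) / 2) x ((dh + dg) / 2).
Proof.
  intros Hh Hg. auto_derive.
  - split; [eexists; apply Hh|]. split; [eexists; apply Hg|exact I].
  - change (Derive (fun y => h y) x) with (Derive h x). change (Derive (fun y => g y) x) with (Derive g x).
    rewrite (is_derive_unique _ _ _ Hh), (is_derive_unique _ _ _ Hg). field.
Qed.

Lemma is_derive_half_minus (h g : R -> R) (x dh dg : R) :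
  is_derive h x dh -> is_derive g x dg -> is_derive (fun y => (h y - g y) / 2) x ((dh - dg) / 2).
Proof.
  intros Hh Hg. auto_derive.
  - split; [eexists; apply Hh|]. split; [eexists; apply Hg|exact I].
  - change (Derive (fun y => h y) x) with (Derive h x). change (Derive (fun y => g y) x) with (Derive g x).
    rewrite (is_derive_unique _ _ _ Hh), (is_derive_unique _ _ _ Hg). field.
Qed.

(** The contribution of a source [F] to the slope [u_x]. *)
Definition duhamel_odd (F : R -> R -> R) (x t : R) : R :=
  (char_int 1 F x t - char_int (-1) F x t) / 2.

Lemma cont2_duhamel_odd (F : R -> R -> R) : cont2 F -> cont2 (duhamel_odd F).
Proof.
  intros HF. apply (cont2_ext (fun x t => / 2 * (char_int 1 F x t - char_int (-1) F x t))).
  - intros x t. unfold duhamel_odd. field.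
  - apply cont2_scal, cont2_minus; now apply cont2_char_int.
Qed.

(** The half difference [q] of the two Riemann invariants has the same mixed
    derivative as [v], namely [q_t = v_x], and it equals [u_x] at time [0].  So [q]
    is the [x]-derivative of [u0 + int_0^t v], and the wave equation can be read
    off from the transport equations of the two invariants. *)
Theorem wave_of_velocity (T : R) (u0 u1 d1 d2 e1 : R -> R) (v F Fx : R -> R -> R) :
  (forall z, is_derive u0 z (d1 z)) -> (forall z, is_derive d1 z (d2 z)) ->
  (forall z, is_derive u1 z (e1 z)) ->
  (forall z, continuous d2 z) -> (forall z, continuous e1 z) ->
  C1x F Fx ->
  (forall x t, v x t =
     dalembert (fun z => u1 z + d1 z) (fun z => u1 z - d1 z) x t + duhamel F x t) ->
  exists u ux uxx uxt utx utt,
    C2_strip T u ux v uxx uxt utx utt /\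
    (forall x t, utt x t - uxx x t = F x t) /\
    (forall x, u x 0 = u0 x) /\ (forall x, v x 0 = u1 x).
Proof.
  intros Hu0 Hd1 Hu1 Hcd2 Hce1 [HF [HFx HdF]] Hv.
  set (k := fun z => u1 z + d1 z) in *. set (l := fun z => u1 z - d1 z) in *.
  set (dk := fun z => e1 z + d2 z). set (dl := fun z => e1 z - d2 z).
  assert (Hk : forall z, is_derive k z (dk z)).
  { intros z. apply (@is_derive_plus R_AbsRing R_NormedModule); [apply Hu1|apply Hd1]. }
  assert (Hl : forall z, is_derive l z (dl z)).
  { intros z. apply (@is_derive_minus R_AbsRing R_NormedModule); [apply Hu1|apply Hd1]. }
  assert (Hlo : forall z, is_derive (fun z => - l z) z (- dl z)).
  { intros z. apply (@is_derive_opp R_AbsRing R_NormedModule); apply Hl. }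
  assert (Hcdk : forall z, continuous dk z).
  { intros z. apply (@continuous_plus _ R_AbsRing R_NormedModule); [apply Hce1|apply Hcd2]. }
  assert (Hcdl : forall z, continuous dl z).
  { intros z. apply (@continuous_minus _ R_AbsRing R_NormedModule); [apply Hce1|apply Hcd2]. }
  assert (Hcdlo : forall z, continuous (fun z => - dl z) z).
  { intros z. apply (@continuous_opp _ R_AbsRing R_NormedModule); apply Hcdl. }
  set (vx := fun x t => dalembert dk dl x t + duhamel Fx x t).
  set (q := fun x t => dalembert k (fun z => - l z) x t + duhamel_odd F x t).
  set (qx := fun x t => dalembert dk (fun z => - dl z) x t + duhamel_odd Fx x t).
  set (vt := fun x t => dalembert dk (fun z => - dl z) x t + (F x t + duhamel_odd Fx x t)).
  assert (Hcvx : cont2 vx).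
  { apply cont2_plus; [now apply cont2_dalembert|now apply cont2_duhamel]. }
  assert (Hcqx : cont2 qx).
  { apply cont2_plus; [now apply cont2_dalembert|now apply cont2_duhamel_odd]. }
  assert (Hcvt : cont2 vt).
  { apply cont2_plus; [now apply cont2_dalembert|apply cont2_plus; [exact HF|now apply cont2_duhamel_odd]]. }
  assert (Hcq : cont2 q).
  { apply cont2_plus; [|now apply cont2_duhamel_odd].
    apply cont2_dalembert; eapply C1_continuous; first [exact Hk|exact Hl|exact Hlo|exact Hu0]. }
  assert (Hcv : cont2 v).
  { apply (cont2_ext (fun x t => dalembert k l x t + duhamel F x t)); [intros; now rewrite Hv|].
    apply cont2_plus; [|now apply cont2_duhamel].
    apply cont2_dalembert; eapply C1_continuous; first [exact Hk|exact Hl|exact Hlo|exact Hu0]. }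
  assert (Dvx : forall x t, is_derive (fun y => v y t) x (vx x t)).
  { intros x t. apply (is_derive_ext (fun y => dalembert k l y t + duhamel F y t)).
    { intros; now rewrite Hv. }
    apply (@is_derive_plus R_AbsRing R_NormedModule); [now apply is_derive_dalembert_x|].
    apply is_derive_half_plus; now apply char_int_dx. }
  assert (Dvt : forall x t, is_derive (fun s => v x s) t (vt x t)).
  { intros x t. apply (is_derive_ext (fun s => dalembert k l x s + duhamel F x s)).
    { intros; now rewrite Hv. }
    apply (@is_derive_plus R_AbsRing R_NormedModule); [now apply is_derive_dalembert_t|].
    replace (F x t + duhamel_odd Fx x t) with
      ((F x t + 1 * char_int 1 Fx x t + (F x t + -1 * char_int (-1) Fx x t)) / 2)
      by (unfold duhamel_odd; field).
    apply is_derive_half_plus; now apply char_int_dt. }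
  assert (Dqx : forall x t, is_derive (fun y => q y t) x (qx x t)).
  { intros x t.
    apply (@is_derive_plus R_AbsRing R_NormedModule); [now apply is_derive_dalembert_x|].
    apply is_derive_half_minus; now apply char_int_dx. }
  (* the sources of the two invariants cancel *)
  assert (Dqt : forall x t, is_derive (fun s => q x s) t (vx x t)).
  { intros x t.
    apply (@is_derive_plus R_AbsRing R_NormedModule).
    - replace (dalembert dk dl x t) with (dalembert dk (fun z => - - dl z) x t)
        by (unfold dalembert; now rewrite Ropp_involutive).
      now apply (is_derive_dalembert_t k (fun z => - l z) dk (fun z => - dl z)).
    - replace (duhamel Fx x t) with
      ((F x t + 1 * char_int 1 Fx x t - (F x t + -1 * char_int (-1) Fx x t)) / 2)
      by (unfold duhamel; field).
      apply is_derive_half_minus; now apply char_int_dt. }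
  assert (Hq0 : forall x, q x 0 = d1 x).
  { intros x. unfold q, dalembert, duhamel_odd. rewrite !char_int_at_0. unfold k, l.
    rewrite Rplus_0_r, Rminus_0_r. field. }
  assert (Hqint : forall x t, q x t = d1 x + char_int 0 vx x t).
  { intros x t. 
    assert (HI : is_RInt (fun s => vx x s) 0 t (minus (q x t) (q x 0))).
    { apply (is_RInt_derive (fun s => q x s)); intros s _; [apply Dqt|].
      apply (cont2_comp vx); [exact Hcvx|apply continuous_const|apply continuous_id]. }
    apply (@is_RInt_unique R_CompleteNormedModule) in HI.
    change (minus (q x t) (q x 0)) with (q x t - q x 0) in HI. rewrite Hq0 in HI.
    unfold char_int. rewrite (RInt_ext _ (fun s => vx x s)).
    - rewrite HI. ring.
    - intros s _. f_equal. ring. }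
  exists (fun x t => u0 x + char_int 0 v x t), q, qx, vx, vx, vt.
  split; [split; [|split]|split; [|split]].
  - apply C1_strip_of_plane; try assumption.
    + apply (cont2_plus (fun x t => u0 x)); [|now apply cont2_char_int].
      apply (cont2_app u0 (fun x t => x)); [eapply C1_continuous; first [exact Hk|exact Hl|exact Hlo|exact Hu0]|apply cont2_fst].
    + intros x t. rewrite Hqint.
      apply (@is_derive_plus R_AbsRing R_NormedModule); [apply Hu0|now apply char_int_dx].
    + intros x t. replace (v x t) with (0 + (v x t + 0 * char_int 0 vx x t)) by ring.
      apply (@is_derive_plus R_AbsRing R_NormedModule (fun _ => u0 x));
        [apply (@is_derive_const R_AbsRing R_NormedModule)|now apply char_int_dt].
  - now apply C1_strip_of_plane.
  - now apply C1_strip_of_plane.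
  - intros x t. unfold vt, qx. ring.
  - intros x. rewrite char_int_at_0. ring.
  - intros x. rewrite Hv. unfold dalembert, duhamel. rewrite !char_int_at_0. unfold k, l.
    rewrite Rplus_0_r, Rminus_0_r. field.
Qed.

(** * The power nonlinearity and its truncation *)

Lemma Rpower_pos (x y : R) : 0 < Rpower x y.
Proof. apply exp_pos. Qed.

Lemma abs_pow_0 (p : R) : abs_pow 0 p = 0.
Proof. unfold abs_pow. destruct (Req_dec_T 0 0); [reflexivity|congruence]. Qed.

Lemma abs_pow_neq0 (z p : R) : z <> 0 -> abs_pow z p = Rpower (Rabs z) p.
Proof. intros H. unfold abs_pow. destruct (Req_dec_T z 0); [congruence|reflexivity]. Qed.

Lemma abs_pow_pos (z p : R) : 0 < z -> abs_pow z p = Rpower z p.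
Proof. intros H. rewrite abs_pow_neq0 by lra. now rewrite Rabs_right by lra. Qed.

Lemma abs_pow_opp (z p : R) : abs_pow (- z) p = abs_pow z p.
Proof.
  destruct (Req_dec z 0) as [->|H]; [now rewrite Ropp_0|].
  rewrite !abs_pow_neq0 by lra. now rewrite Rabs_Ropp.
Qed.

Lemma abs_pow_ge0 (z p : R) : 0 <= abs_pow z p.
Proof. unfold abs_pow. destruct (Req_dec_T z 0); [lra|left; apply Rpower_pos]. Qed.

Lemma abs_pow_le (z y p : R) : 0 < p -> 0 < y -> Rabs z <= y -> abs_pow z p <= Rpower y p.
Proof.
  intros Hp Hy H. unfold abs_pow. destruct (Req_dec_T z 0); [left; apply Rpower_pos|].
  apply Rle_Rpower_l; [lra|]. split; [now apply Rabs_pos_lt|exact H].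
Qed.

Lemma is_derive_Rpower (z p : R) : 0 < z ->
  is_derive (fun z => Rpower z p) z (p * Rpower z (p - 1)).
Proof. intros Hz. apply is_derive_Reals. now apply derivable_pt_lim_power. Qed.

Lemma locally_lt (c z : R) : c < z -> locally z (fun y => c < y).
Proof.
  intros H. assert (Hd : 0 < z - c) by lra. exists (mkposreal _ Hd). intros y Hy.
  change (Rabs (y - z) < z - c) in Hy. apply Rabs_def2 in Hy. lra.
Qed.

Lemma is_derive_abs_pow_pos (z p : R) : 0 < z ->
  is_derive (fun z => abs_pow z p) z (p * abs_pow z (p - 1)).
Proof.
  intros Hz. apply (is_derive_ext_loc (fun z => Rpower z p)).
  - generalize (locally_lt 0 z Hz). apply filter_imp. intros y Hy. now rewrite abs_pow_pos.
  - rewrite abs_pow_pos by exact Hz. now apply is_derive_Rpower.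
Qed.

Lemma is_derive_abs_pow_neg (z p : R) : z < 0 ->
  is_derive (fun z => abs_pow z p) z (- (p * abs_pow z (p - 1))).
Proof.
  intros Hz. apply (is_derive_ext (fun z => abs_pow (- z) p)).
  - intros y. apply abs_pow_opp.
  - replace (- (p * abs_pow z (p - 1))) with (-1 * (p * abs_pow (- z) (p - 1)))
      by (rewrite abs_pow_opp; ring).
    apply (is_derive_comp (fun z => abs_pow z p) Ropp).
    + apply is_derive_abs_pow_pos. lra.
    + auto_derive; [exact I|ring].
Qed.

Lemma abs_pow_small (e s : R) : 0 < s -> 0 < e ->
  exists d, 0 < d /\ forall z, Rabs z < d -> abs_pow z s < e.
Proof.
  intros Hs He. exists (Rpower e (/ s)). split; [apply Rpower_pos|].
  intros z Hz. destruct (Req_dec z 0) as [->|H]; [now rewrite abs_pow_0|].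
  rewrite abs_pow_neq0 by exact H.
  rewrite <- (Rpower_1 e) by exact He. replace 1 with (/ s * s) by (field; lra).
  rewrite <- Rpower_mult. apply Rlt_Rpower_l; [exact Hs|].
  split; [now apply Rabs_pos_lt|exact Hz].
Qed.

Lemma continuous_abs_pow (s z : R) : 0 < s -> continuous (fun z => abs_pow z s) z.
Proof.
  intros Hs. destruct (Rtotal_order z 0) as [H|[->|H]].
  - apply (@ex_derive_continuous R_AbsRing R_NormedModule). eexists. now apply is_derive_abs_pow_neg.
  - apply continuity_pt_filterlim. intros e He.
    destruct (abs_pow_small e s Hs He) as [d [Hd Hz]].
    exists d. split; [exact Hd|]. intros y [_ Hy]. simpl in *. unfold Rdist in *.
    rewrite abs_pow_0, Rminus_0_r, Rabs_right by (apply Rle_ge, abs_pow_ge0).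
    apply Hz. now rewrite Rminus_0_r in Hy.
  - apply (@ex_derive_continuous R_AbsRing R_NormedModule). eexists. now apply is_derive_abs_pow_pos.
Qed.

(** [p |z|^(p-1) sign z], in a form that makes continuity at [0] immediate. *)
Definition dabs_pow (p z : R) : R :=
  p * (abs_pow (Rmax z 0) (p - 1) - abs_pow (Rmax (- z) 0) (p - 1)).

(** At [0] the difference quotient is [|h|^(p-1)] up to sign, which tends to [0]
    because [p > 1]. *)
Lemma is_derive_abs_pow (p z : R) : 1 < p ->
  is_derive (fun z => abs_pow z p) z (dabs_pow p z).
Proof.
  intros Hp. unfold dabs_pow. destruct (Rtotal_order z 0) as [H|[->|H]].
  - rewrite (Rmax_right z) by lra. rewrite (Rmax_left (- z)) by lra.
    rewrite abs_pow_0, abs_pow_opp.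
    replace (p * (0 - abs_pow z (p - 1))) with (- (p * abs_pow z (p - 1))) by ring.
    now apply is_derive_abs_pow_neg.
  - rewrite Ropp_0, Rmax_left, abs_pow_0 by lra.
    apply is_derive_Reals. intros e He.
    destruct (abs_pow_small e (p - 1) ltac:(lra) He) as [d [Hd Hz]].
    exists (mkposreal d Hd). simpl. intros h Hh Hhd. rewrite Rplus_0_l, abs_pow_0.
    replace ((abs_pow h p - 0) / h - p * (0 - 0)) with (abs_pow h p / h) by (field; exact Hh).
    specialize (Hz h Hhd). rewrite abs_pow_neq0 in * by exact Hh.
    unfold Rdiv. rewrite Rabs_mult, Rabs_inv, (Rabs_right (Rpower _ _)) by (left; apply Rpower_pos).
    replace (Rpower (Rabs h) p) with (Rpower (Rabs h) (p - 1) * Rpower (Rabs h) 1)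
      by (rewrite <- Rpower_plus; f_equal; ring).
    pose proof (Rabs_pos_lt h Hh). rewrite Rpower_1 by assumption.
    rewrite Rmult_assoc, Rinv_r, Rmult_1_r by lra. exact Hz.
  - rewrite (Rmax_left z) by lra. rewrite (Rmax_right (- z)) by lra. rewrite abs_pow_0, Rminus_0_r.
    now apply is_derive_abs_pow_pos.
Qed.

Definition clip (z : R) : R := Rmax (-1) (Rmin 1 z).

Definition dtrunc_pow (p z : R) : R := dabs_pow p (clip z).

(** Obtained by freezing the derivative of [|z|^p] for [|z| > 1] and
    integrating, which makes it [C^1] and Lipschitz without any gluing. *)
Definition trunc_pow (p z : R) : R := RInt (dtrunc_pow p) 0 z.

Lemma continuous_Rmax_const (c z : R) : continuous (fun z => Rmax z c) z.
Proof.
  apply (continuous_ext (fun z => (z + c + Rabs (z - c)) / 2)).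
  - intros y. unfold Rmax, Rabs. destruct (Rle_dec y c), (Rcase_abs (y - c)); simpl; lra.
  - apply continuity_pt_filterlim. apply continuity_pt_div.
    + apply continuity_pt_plus; [apply continuity_pt_plus|].
      * apply derivable_continuous_pt, derivable_pt_id.
      * apply continuity_pt_const. now intros ? ?.
      * apply (continuity_pt_comp (fun y => y - c) Rabs); [|apply Rcontinuity_abs].
        apply continuity_pt_minus; [apply derivable_continuous_pt, derivable_pt_id|].
        apply continuity_pt_const. now intros ? ?.
    + apply continuity_pt_const. now intros ? ?.
    + lra.
Qed.

Lemma continuous_clip (z : R) : continuous clip z.
Proof.
  apply (continuous_ext (fun z => Rmax (- Rmax (- z) (-1)) (-1))).
  - intros y. unfold clip, Rmax, Rmin. repeat destruct Rle_dec; simpl; lra.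
  - assert (Ho : forall y, continuous Ropp y).
    { intros y. apply (@continuous_opp _ R_AbsRing R_NormedModule (fun y => y)), continuous_id. }
    apply (continuous_comp (fun z => - Rmax (- z) (-1)) (fun z => Rmax z (-1)));
      [|apply continuous_Rmax_const].
    apply (continuous_comp (fun z => Rmax (- z) (-1)) Ropp); [|apply Ho].
    apply (continuous_comp Ropp (fun z => Rmax z (-1))); [apply Ho|apply continuous_Rmax_const].
Qed.

Lemma continuous_dabs_pow (p z : R) : 1 < p -> continuous (dabs_pow p) z.
Proof.
  intros Hp. apply (@continuous_mult _ R_AbsRing (fun _ => p)); [apply continuous_const|].
  assert (Hs : forall y, continuous (fun z => abs_pow z (p - 1)) y).
  { intros y. apply continuous_abs_pow. lra. }
  apply (@continuous_minus _ R_AbsRing R_NormedModule).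
  - apply (continuous_comp (fun z => Rmax z 0) (fun z => abs_pow z (p - 1)));
      [apply continuous_Rmax_const|apply Hs].
  - apply (continuous_comp (fun z => Rmax (- z) 0) (fun z => abs_pow z (p - 1))); [|apply Hs].
    apply (continuous_comp Ropp (fun z => Rmax z 0)); [|apply continuous_Rmax_const].
    apply (@continuous_opp _ R_AbsRing R_NormedModule (fun y => y)), continuous_id.
Qed.

Lemma continuous_dtrunc_pow (p z : R) : 1 < p -> continuous (dtrunc_pow p) z.
Proof.
  intros Hp. apply (continuous_comp clip (dabs_pow p)); [apply continuous_clip|].
  now apply continuous_dabs_pow.
Qed.

Lemma is_derive_trunc_pow (p z : R) : 1 < p -> is_derive (trunc_pow p) z (dtrunc_pow p z).
Proof.
  intros Hp. apply (is_derive_RInt (dtrunc_pow p) (trunc_pow p) 0 z).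
  - apply filter_forall. intros y. apply (@RInt_correct R_CompleteNormedModule).
    apply ex_RInt_cont. intros s. now apply continuous_dtrunc_pow.
  - now apply continuous_dtrunc_pow.
Qed.

Lemma dtrunc_pow_bound (p z : R) : 1 < p -> Rabs (dtrunc_pow p z) <= p.
Proof.
  intros Hp. unfold dtrunc_pow, dabs_pow.
  assert (H : forall y, -1 <= y <= 1 -> 0 <= abs_pow (Rmax y 0) (p - 1) <= 1).
  { intros y Hy. split; [apply abs_pow_ge0|].
    replace 1 with (Rpower 1 (p - 1)) at 2.
    - apply abs_pow_le; [lra|lra|].
      unfold Rmax. destruct Rle_dec; rewrite Rabs_right; lra.
    - unfold Rpower. now rewrite ln_1, Rmult_0_r, exp_0. }
  assert (Hc : -1 <= clip z <= 1).
  { unfold clip, Rmax, Rmin. repeat destruct Rle_dec; lra. }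
  assert (h1 := H (clip z) Hc). assert (h2 := H (- clip z) ltac:(lra)).
  rewrite Rabs_mult, (Rabs_right p) by lra.
  apply Rle_trans with (p * 1); [|lra]. apply Rmult_le_compat_l; [lra|].
  apply Rabs_le_between. lra.
Qed.

Lemma trunc_pow_eq (p z : R) : 1 < p -> Rabs z <= 1 -> trunc_pow p z = abs_pow z p.
Proof.
  intros Hp Hz. apply Rabs_le_between in Hz. unfold trunc_pow.
  assert (Hi : forall y, Rmin 0 z <= y <= Rmax 0 z -> clip y = y).
  { intros y. unfold clip, Rmax, Rmin. repeat destruct Rle_dec; lra. }
  rewrite (RInt_ext _ (dabs_pow p)).
  2:{ intros y Hy. unfold dtrunc_pow. rewrite Hi; [reflexivity|lra]. }
  assert (HI : is_RInt (dabs_pow p) 0 z (minus (abs_pow z p) (abs_pow 0 p))).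
  { apply (is_RInt_derive (fun z => abs_pow z p)); intros y _.
    - now apply is_derive_abs_pow.
    - now apply continuous_dabs_pow. }
  apply (@is_RInt_unique R_CompleteNormedModule) in HI. rewrite HI.
  change (abs_pow z p - abs_pow 0 p = abs_pow z p). rewrite abs_pow_0. ring.
Qed.

(** * The weight *)

Lemma japanese_pos (z : R) : 0 < japanese z.
Proof. apply sqrt_lt_R0. pose proof (pow2_ge_0 z). lra. Qed.

Lemma japanese_sqr (z : R) : japanese z * japanese z = 1 + z ^ 2.
Proof. apply sqrt_sqrt. pose proof (pow2_ge_0 z). lra. Qed.

Lemma is_derive_japanese (z : R) : is_derive japanese z (z / japanese z).
Proof.
  unfold japanese. auto_derive.
  - pose proof (pow2_ge_0 z). lra.
  - simpl. field. apply Rgt_not_eq. pose proof (japanese_pos z) as H. unfold japanese in H. simpl in H. exact H.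
Qed.

Lemma continuous_japanese (z : R) : continuous japanese z.
Proof. apply (C1_continuous _ _ is_derive_japanese). Qed.

Definition jpow (s z : R) : R := Rpower (japanese z) s.
Definition djpow (s z : R) : R := s * jpow (s - 1) z * (z / japanese z).

Lemma is_derive_jpow (s z : R) : is_derive (jpow s) z (djpow s z).
Proof.
  unfold djpow, jpow. rewrite Rmult_comm.
  apply (is_derive_comp (fun y => Rpower y s) japanese).
  - apply is_derive_Rpower, japanese_pos.
  - apply is_derive_japanese.
Qed.

Lemma continuous_jpow (s z : R) : continuous (jpow s) z.
Proof. apply (C1_continuous _ _ (is_derive_jpow s)). Qed.

Lemma continuous_djapanese (z : R) : continuous (fun z => z / japanese z) z.
Proof.
  apply (@ex_derive_continuous R_AbsRing R_NormedModule). auto_derive.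
  split; [eexists; apply is_derive_japanese|]. split; [|exact I].
  apply Rgt_not_eq, japanese_pos.
Qed.

Lemma continuous_djpow (s z : R) : continuous (djpow s) z.
Proof.
  apply (@continuous_mult _ R_AbsRing (fun z => s * jpow (s - 1) z)); [|apply continuous_djapanese].
  apply (@continuous_mult _ R_AbsRing (fun _ => s)); [apply continuous_const|apply continuous_jpow].
Qed.

Definition weight (a b x t : R) : R :=
  jpow (- (1 + a)) (t + japanese x) * jpow (- (1 + b)) (t - japanese x).

Lemma weight_eq (a b x t : R) : weight a b x t =
  / (Rpower (japanese (t + japanese x)) (1 + a) * Rpower (japanese (t - japanese x)) (1 + b)).
Proof. unfold weight, jpow. rewrite !Rpower_Ropp, Rinv_mult. reflexivity. Qed.

Lemma weight_pos (a b x t : R) : 0 < weight a b x t.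
Proof. apply Rmult_lt_0_compat; apply Rpower_pos. Qed.

Lemma C1x_weight (a b : R) : exists Wx, C1x (weight a b) Wx.
Proof.
  exists (fun x t => 
     x / japanese x * djpow (- (1 + a)) (t + japanese x) * jpow (- (1 + b)) (t - japanese x)
     + jpow (- (1 + a)) (t + japanese x) * (- (x / japanese x) * djpow (- (1 + b)) (t - japanese x))).
  assert (Hj : cont2 (fun x t => japanese x)).
  { apply (cont2_app japanese (fun x t => x)); [apply continuous_japanese|apply cont2_fst]. }
  assert (Hdj : cont2 (fun x t => x / japanese x)).
  { apply (cont2_app (fun z => z / japanese z) (fun x t => x)); [apply continuous_djapanese|apply cont2_fst]. }
  assert (Hp : cont2 (fun x t => t + japanese x)) by (apply cont2_plus; [apply cont2_snd|exact Hj]).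
  assert (Hm : cont2 (fun x t => t - japanese x)) by (apply cont2_minus; [apply cont2_snd|exact Hj]).
  assert (Ha : cont2 (fun x t => jpow (- (1 + a)) (t + japanese x))) by (apply cont2_app; [apply continuous_jpow|exact Hp]).
  assert (Hb : cont2 (fun x t => jpow (- (1 + b)) (t - japanese x))) by (apply cont2_app; [apply continuous_jpow|exact Hm]).
  split; [now apply cont2_mult|]. split.
  - apply cont2_plus.
    + apply cont2_mult; [|exact Hb]. apply cont2_mult; [exact Hdj|].
      apply (cont2_app (djpow (- (1 + a)))); [apply continuous_djpow|exact Hp].
    + apply cont2_mult; [exact Ha|]. apply cont2_mult.
      * apply (cont2_ext (fun x t => -1 * (x / japanese x))); [intros; ring|now apply cont2_scal].
      * apply (cont2_app (djpow (- (1 + b)))); [apply continuous_djpow|exact Hm].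
  - intros x t. unfold weight.
    apply (is_derive_mult (fun x => jpow (- (1 + a)) (t + japanese x)) (fun x => jpow (- (1 + b)) (t - japanese x))).
    + apply (is_derive_comp (jpow (- (1 + a))) (fun x => t + japanese x)); [apply is_derive_jpow|].
      rewrite <- (Rplus_0_l (x / japanese x)).
      apply (@is_derive_plus R_AbsRing R_NormedModule (fun _ => t));
        [apply (@is_derive_const R_AbsRing R_NormedModule)|apply is_derive_japanese].
    + apply (is_derive_comp (jpow (- (1 + b))) (fun x => t - japanese x)); [apply is_derive_jpow|].
      rewrite <- (Rminus_0_l (x / japanese x)).
      apply (@is_derive_minus R_AbsRing R_NormedModule (fun _ => t));
        [apply (@is_derive_const R_AbsRing R_NormedModule)|apply is_derive_japanese].
    + intros; apply Rmult_comm.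
Qed.

Lemma japanese_lower (z : R) : (1 + Rabs z) / 2 <= japanese z.
Proof.
  pose proof (japanese_sqr z). pose proof (japanese_pos z). pose proof (Rabs_pos z).
  pose proof (pow2_abs z). apply Rnot_lt_le. intros Hc.
  assert (japanese z * japanese z < (1 + Rabs z) / 2 * ((1 + Rabs z) / 2)) by (apply Rmult_le_0_lt_compat; lra).
  pose proof (pow2_ge_0 (Rabs z - 1)). nra.
Qed.

Lemma japanese_upper (z : R) : japanese z <= 1 + Rabs z.
Proof.
  pose proof (japanese_sqr z). pose proof (japanese_pos z). pose proof (Rabs_pos z).
  pose proof (pow2_abs z). apply Rnot_lt_le. intros Hc. nra.
Qed.

Lemma japanese_ge_abs (z : R) : Rabs z <= japanese z.
Proof.
  pose proof (japanese_sqr z). pose proof (japanese_pos z). pose proof (Rabs_pos z).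
  pose proof (pow2_abs z). apply Rnot_lt_le. intros Hc. nra.
Qed.

(** For [s < 0] the other one of the two comparisons is used. *)
Lemma jpow_comparable (s z y D : R) :
  1 <= D -> 0 < y -> japanese z <= D * y -> y <= D * japanese z ->
  jpow s z <= Rpower D (Rabs s) * Rpower y s.
Proof.
  intros HD Hy Hu Hl. unfold jpow. pose proof (japanese_pos z) as Hj.
  destruct (Rle_dec 0 s) as [Hs|Hs].
  - rewrite Rabs_right by lra. rewrite Rpower_mult_distr by lra.
    apply Rle_Rpower_l; lra.
  - rewrite Rabs_left by lra.
    replace s with (- - s) at 1 3 by ring. set (r := - s). assert (0 < r) by (unfold r; lra).
    rewrite !(Rpower_Ropp _ r).
    assert (Hr : Rpower y r <= Rpower D r * Rpower (japanese z) r).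
    { rewrite Rpower_mult_distr by lra. apply Rle_Rpower_l; lra. }
    apply (Rmult_le_reg_r (Rpower (japanese z) r * Rpower y r)).
    { apply Rmult_lt_0_compat; apply Rpower_pos. }
    pose proof (Rpower_pos y r). pose proof (Rpower_pos (japanese z) r).
    replace (/ Rpower (japanese z) r * (Rpower (japanese z) r * Rpower y r)) with (Rpower y r)
      by (field; lra).
    replace (Rpower D r * / Rpower y r * (Rpower (japanese z) r * Rpower y r))
      with (Rpower D r * Rpower (japanese z) r) by (field; lra).
    exact Hr.
Qed.

(** On the support [|x| <= t + r] the two brackets are comparable with
    [t + |x| + r + 1] and [t - |x| + r + 1]; both of these are at least [1]. *)
Lemma weight_bound (a b r x t : R) :
  1 <= r -> 0 <= t -> Rabs x <= t + r ->
  weight a b x t <= Rpower (2 * (r + 2)) (Rabs (1 + a)) * Rpower (2 * (r + 2)) (Rabs (1 + b))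
     * (Rpower (t + Rabs x + r + 1) (- (1 + a)) * Rpower (t - Rabs x + r + 1) (- (1 + b))).
Proof.
  intros Hr Ht Hx. pose proof (Rabs_pos x) as Hx0.
  pose proof (japanese_ge_abs x) as Hj1. pose proof (japanese_upper x) as Hj2.
  set (D := 2 * (r + 2)). set (M := t + Rabs x + r + 1). set (m := t - Rabs x + r + 1).
  assert (HD : 1 <= D) by (unfold D; lra).
  assert (H1 : jpow (- (1 + a)) (t + japanese x) <= Rpower D (Rabs (1 + a)) * Rpower M (- (1 + a))).
  { rewrite <- (Rabs_Ropp (1 + a)). pose proof (japanese_upper (t + japanese x)) as u1.
    pose proof (japanese_lower (t + japanese x)) as u2.
    rewrite Rabs_right in u1, u2 by lra.
    apply jpow_comparable; unfold D, M; nra. }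
  assert (H2 : jpow (- (1 + b)) (t - japanese x) <= Rpower D (Rabs (1 + b)) * Rpower m (- (1 + b))).
  { rewrite <- (Rabs_Ropp (1 + b)). pose proof (japanese_upper (t - japanese x)) as u1.
    pose proof (japanese_lower (t - japanese x)) as u2.
    assert (u3 : Rabs (t - japanese x) <= Rabs (t - Rabs x) + 1).
    { unfold Rabs at 1 2. repeat destruct Rcase_abs; lra. }
    assert (u4 : t - Rabs x <= Rabs (t - japanese x) + 1).
    { unfold Rabs at 2. destruct Rcase_abs; lra. }
    assert (u5 : Rabs (t - Rabs x) <= Rmax (t - Rabs x) r).
    { unfold Rmax, Rabs at 1. destruct Rle_dec, Rcase_abs; lra. }
    assert (u6 : 1 <= m) by (unfold m; lra).
    pose proof (Rabs_pos (t - japanese x)).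
    apply jpow_comparable; [exact HD|lra| |].
    - assert (Rmax (t - Rabs x) r + 2 <= D * m).
      { unfold Rmax. destruct Rle_dec; unfold D; [nra|]. unfold m; nra. }
      lra.
    - assert (m <= (r + 2) * (1 + Rabs (t - japanese x))) by (unfold m; nra).
      unfold D. nra. }
  unfold weight.
  apply Rle_trans with ((Rpower D (Rabs (1 + a)) * Rpower M (- (1 + a)))
     * (Rpower D (Rabs (1 + b)) * Rpower m (- (1 + b)))); [|right; ring].
  apply Rmult_le_compat; try assumption; left; apply Rpower_pos.
Qed.

(** * Estimate of the source by an envelope *)

Lemma Rpower_ge1 (x y : R) : 1 <= x -> 0 <= y -> 1 <= Rpower x y.
Proof.
  intros Hx Hy. rewrite <- (Rpower_O x) at 1 by lra. now apply Rle_Rpower.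
Qed.

Lemma Rpower_mult_base (x y s : R) : 0 < x -> 0 < y -> Rpower (x * y) s = Rpower x s * Rpower y s.
Proof. intros Hx Hy. now rewrite Rpower_mult_distr. Qed.

Lemma Rpower_sum_le (u v p : R) : 0 < u -> 0 < v -> 0 <= p ->
  Rpower (u + v) p <= Rpower 2 p * (Rpower u p + Rpower v p).
Proof.
  intros Hu Hv Hp.
  pose proof (Rpower_pos u p). pose proof (Rpower_pos v p). pose proof (Rpower_pos 2 p).
  destruct (Rle_dec u v) as [Huv|Huv].
  - apply Rle_trans with (Rpower (2 * v) p); [apply Rle_Rpower_l; lra|].
    rewrite Rpower_mult_base by lra. apply Rmult_le_compat_l; lra.
  - apply Rle_trans with (Rpower (2 * u) p); [apply Rle_Rpower_l; lra|].
    rewrite Rpower_mult_base by lra. apply Rmult_le_compat_l; lra.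
Qed.

Lemma Rpower_anti (x y s : R) : 0 < x -> x <= y -> 0 <= s -> Rpower y (- s) <= Rpower x (- s).
Proof.
  intros Hx Hxy Hs. rewrite !Rpower_Ropp. apply Rinv_le_contravar; [apply Rpower_pos|].
  apply Rle_Rpower_l; lra.
Qed.

(** The majorant of the velocity at distance about [y] from the light cone: the
    free wave and what interaction sends into the interior. *)
Definition envelope (eps K1 K2 mu N al y : R) : R :=
  eps * (K1 * Rpower y (- N) + K2 * mu * Rpower y (- al)).

Lemma envelope_pos (eps K1 K2 mu N al y : R) :
  0 < eps -> 0 < K1 -> 0 < K2 -> 0 < mu -> 0 < envelope eps K1 K2 mu N al y.
Proof.
  intros He H1 H2 Hm. unfold envelope.
  pose proof (Rpower_pos y (- N)). pose proof (Rpower_pos y (- al)).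
  apply Rmult_lt_0_compat; [exact He|].
  apply Rplus_lt_0_compat; repeat apply Rmult_lt_0_compat; assumption.
Qed.

Lemma envelope_anti (eps K1 K2 mu N al y z : R) :
  0 < eps -> 0 < K1 -> 0 < K2 -> 0 < mu -> 0 <= N -> 0 <= al -> 0 < y -> y <= z ->
  envelope eps K1 K2 mu N al z <= envelope eps K1 K2 mu N al y.
Proof.
  intros He H1 H2 Hm HN Ha Hy Hyz. unfold envelope.
  pose proof (Rpower_anti y z N Hy Hyz HN). pose proof (Rpower_anti y z al Hy Hyz Ha).
  apply Rmult_le_compat_l; [lra|]. apply Rplus_le_compat.
  - apply Rmult_le_compat_l; lra.
  - apply Rmult_le_compat_l; [|assumption]. apply Rmult_le_pos; lra.
Qed.

(** [Rmin X Z] and [Rmax X Z] measure the distance to the cone and the time.  Both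
    orders of [X] and [Z] give the same bound: for the near-cone part because [N]
    absorbs [q], and for the interior part because [q - (p - 1) al >= 0] allows
    replacing [Z] by the larger [X]. *)
Lemma source_bound (p q al N eps K1 K2 mu X Z : R) :
  1 < p -> 0 <= al -> 0 <= N -> (p - 1) * al <= q -> q + 2 <= p * N -> q + N <= p * N ->
  0 < eps -> 0 < K1 -> 0 < K2 -> 0 < mu -> 1 <= X -> 1 <= Z ->
  Rpower (envelope eps K1 K2 mu N al (Rmin X Z)) p
     * (Rpower (Rmax X Z) (- al) * Rpower (Rmin X Z) q)
  <= Rpower (2 * eps) p *
     (Rpower K1 p * (Rpower Z (- N) * Rpower X (- al) + Rpower Z (- al) * Rpower X (- 2))
      + Rpower (K2 * mu) p * (Rpower Z (- al) * Rpower X (q + 1 - p * al - 1))).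
Proof.
  intros Hp Ha HN Hq HN2 HNN He H1 H2 Hm HX HZ.
  set (m := Rmin X Z). set (M := Rmax X Z).
  assert (Hm1 : 1 <= m) by (apply Rmin_glb; assumption).
  assert (HK2 : 0 < K2 * mu) by now apply Rmult_lt_0_compat.
  assert (Hmid : Rpower (envelope eps K1 K2 mu N al m) p <=
     Rpower (2 * eps) p * (Rpower K1 p * Rpower m (- (p * N)) + Rpower (K2 * mu) p * Rpower m (- (p * al)))).
  { unfold envelope. 
    assert (s1 : 0 < K1 * Rpower m (- N)) by (apply Rmult_lt_0_compat; [assumption|apply Rpower_pos]).
    assert (s2 : 0 < K2 * mu * Rpower m (- al)) by (apply Rmult_lt_0_compat; [assumption|apply Rpower_pos]).
    rewrite (Rpower_mult_base eps) by lra. rewrite (Rpower_mult_base 2) by lra.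
    apply Rle_trans with (Rpower eps p * (Rpower 2 p *
       (Rpower (K1 * Rpower m (- N)) p + Rpower (K2 * mu * Rpower m (- al)) p))).
    - apply Rmult_le_compat_l; [left; apply Rpower_pos|]. apply Rpower_sum_le; lra.
    - rewrite (Rpower_mult_base K1), (Rpower_mult_base (K2 * mu)), !Rpower_mult;
        try assumption; try apply Rpower_pos.
      replace (- N * p) with (- (p * N)) by ring. replace (- al * p) with (- (p * al)) by ring.
      right. ring. }
  assert (Q1 : Rpower m (- (p * N)) * (Rpower M (- al) * Rpower m q)
     <= Rpower Z (- N) * Rpower X (- al) + Rpower Z (- al) * Rpower X (- 2)).
  { replace (Rpower m (- (p * N)) * (Rpower M (- al) * Rpower m q))
      with (Rpower M (- al) * Rpower m (q - p * N))
      by (replace (q - p * N) with (- (p * N) + q) by ring; rewrite Rpower_plus; ring).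
    pose proof (Rpower_pos Z (- N)). pose proof (Rpower_pos X (- al)).
    pose proof (Rpower_pos Z (- al)). pose proof (Rpower_pos X (- 2)).
    unfold M, m. destruct (Rle_dec X Z) as [h|h].
    - rewrite Rmax_right, Rmin_left by lra.
      assert (Rpower X (q - p * N) <= Rpower X (- 2)) by (apply Rle_Rpower; lra). nra.
    - rewrite Rmax_left, Rmin_right by lra.
      assert (Rpower Z (q - p * N) <= Rpower Z (- N)) by (apply Rle_Rpower; lra). nra. }
  assert (Q2 : Rpower m (- (p * al)) * (Rpower M (- al) * Rpower m q)
     <= Rpower Z (- al) * Rpower X (q + 1 - p * al - 1)).
  { replace (q + 1 - p * al - 1) with (- (p * al) + q) by ring.
    replace (Rpower m (- (p * al)) * (Rpower M (- al) * Rpower m q))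
      with (Rpower M (- al) * Rpower m (- (p * al) + q)) by (rewrite Rpower_plus; ring).
    unfold M, m. destruct (Rle_dec X Z) as [h|h].
    - rewrite Rmax_right, Rmin_left by lra. lra.
    - rewrite Rmax_left, Rmin_right by lra.
      replace (- (p * al) + q) with (- al + (q - (p - 1) * al)) by ring. rewrite !Rpower_plus.
      assert (Rpower Z (q - (p - 1) * al) <= Rpower X (q - (p - 1) * al)) by (apply Rle_Rpower_l; lra).
      pose proof (Rpower_pos X (- al)). pose proof (Rpower_pos Z (- al)).
      replace (Rpower X (- al) * (Rpower Z (- al) * Rpower Z (q - (p - 1) * al)))
        with (Rpower X (- al) * Rpower Z (- al) * Rpower Z (q - (p - 1) * al)) by ring.
      replace (Rpower Z (- al) * (Rpower X (- al) * Rpower X (q - (p - 1) * al)))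
        with (Rpower X (- al) * Rpower Z (- al) * Rpower X (q - (p - 1) * al)) by ring.
      apply Rmult_le_compat_l; [nra|assumption]. }
  assert (HMm : 0 < Rpower M (- al) * Rpower m q) by (apply Rmult_lt_0_compat; apply Rpower_pos).
  eapply Rle_trans; [apply Rmult_le_compat_r; [lra|exact Hmid]|].
  rewrite Rmult_assoc. apply Rmult_le_compat_l; [left; apply Rpower_pos|].
  rewrite Rmult_plus_distr_r, !Rmult_assoc.
  apply Rplus_le_compat; apply Rmult_le_compat_l; try assumption; left; apply Rpower_pos.
Qed.

(** The label [2 s + c] of the crossing characteristics is the integration
    variable; the characteristic enters the support where this label is [1]. *)
Lemma line_integral_bound (F h : R -> R) (c t Th : R) :
  0 <= t -> (forall s, continuous F s) ->
  (forall X, 1 <= X -> continuous h X) -> (forall X, 1 <= X -> 0 <= h X) ->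
  (forall s, 0 <= s <= t -> 2 * s + c < 1 -> F s = 0) ->
  (forall s, 0 <= s <= t -> 1 <= 2 * s + c -> Rabs (F s) <= h (2 * s + c)) ->
  1 <= Th -> 2 * t + c <= Th ->
  Rabs (RInt F 0 t) <= RInt h 1 Th.
Proof.
  intros Ht HF Hh Hh0 HF0 HFh HTh Htc.
  assert (Hex : forall u v, 1 <= u -> u <= v -> ex_RInt h u v).
  { intros u v Hu Hv. apply (@ex_RInt_continuous R_CompleteNormedModule).
    intros z. rewrite Rmin_left by lra. intros Hz. apply Hh. lra. }
  assert (Hnn : forall u v, 1 <= u -> u <= v -> 0 <= RInt h u v).
  { intros u v Hu Hv. apply RInt_ge_0; [exact Hv|now apply Hex|]. intros z Hz. apply Hh0. lra. }
  assert (Hzero : forall s, 0 <= s <= t -> (forall y, 0 < y < s -> 2 * y + c < 1) -> RInt F 0 s = 0).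
  { intros s Hs Hy. rewrite (RInt_ext F (fun _ => 0)).
    - rewrite RInt_const. unfold scal; simpl; unfold mult; simpl. ring.
    - intros y. rewrite Rmin_left, Rmax_right by lra. intros Hys. apply HF0; [lra|now apply Hy]. }
  destruct (Rlt_dec (2 * t + c) 1) as [Hlt|Hge].
  - rewrite Hzero; [rewrite Rabs_R0; apply Hnn; lra|lra|intros; lra].
  - set (s0 := Rmax 0 ((1 - c) / 2)).
    assert (Hs0 : 0 <= s0 <= t).
    { unfold s0. split; [apply Rmax_l|apply Rmax_lub; lra]. }
    assert (Hs1 : 1 <= 2 * s0 + c).
    { unfold s0. pose proof (Rmax_r 0 ((1 - c) / 2)). lra. }
    assert (HC : RInt F 0 s0 + RInt F s0 t = RInt F 0 t)
      by (apply (RInt_Chasles F); now apply ex_RInt_cont).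
    rewrite <- HC, Hzero, Rplus_0_l; [|exact Hs0|].
    2:{ intros y Hy. unfold s0, Rmax in Hy. destruct Rle_dec; lra. }
    assert (Hl : RInt (fun s => 2 * h (2 * s + c)) s0 t = RInt h (2 * s0 + c) (2 * t + c)).
    { apply (RInt_comp_lin h 2 c s0 t). apply Hex; lra. }
    assert (Hn : norm (RInt F s0 t) <= RInt h (2 * s0 + c) (2 * t + c)).
    { rewrite <- Hl. apply (norm_RInt_le F (fun s => 2 * h (2 * s + c)) s0 t).
      - lra.
      - intros s Hs. apply Rle_trans with (h (2 * s + c)); [apply HFh; lra|].
        pose proof (Hh0 (2 * s + c) ltac:(lra)). lra.
      - apply (@RInt_correct R_CompleteNormedModule). now apply ex_RInt_cont.
      - apply (@RInt_correct R_CompleteNormedModule).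
        apply (@ex_RInt_comp_lin R_NormedModule h 2 c s0 t). apply Hex; lra. }
    eapply Rle_trans; [exact Hn|].
    assert (C1 : RInt h 1 (2 * s0 + c) + RInt h (2 * s0 + c) Th = RInt h 1 Th)
      by (apply (RInt_Chasles h); apply Hex; lra).
    assert (C2 : RInt h (2 * s0 + c) (2 * t + c) + RInt h (2 * t + c) Th = RInt h (2 * s0 + c) Th)
      by (apply (RInt_Chasles h); apply Hex; lra).
    pose proof (Hnn 1 (2 * s0 + c) ltac:(lra) ltac:(lra)).
    pose proof (Hnn (2 * t + c) Th ltac:(lra) ltac:(lra)). lra.
Qed.

(** The exponent is shifted so that the sign of [g] decides between growth
    [Th^g], [ln Th] and boundedness. *)
Definition pow_int (g Th : R) : R := RInt (fun X => Rpower X (g - 1)) 1 Th.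

Lemma continuous_Rpower (s X : R) : 0 < X -> continuous (fun X => Rpower X s) X.
Proof.
  intros HX. apply (@ex_derive_continuous R_AbsRing R_NormedModule).
  eexists. now apply is_derive_Rpower.
Qed.

Lemma ex_pow_int (s Th : R) : 1 <= Th -> ex_RInt (fun X => Rpower X s) 1 Th.
Proof.
  intros H. apply (@ex_RInt_continuous R_CompleteNormedModule).
  intros z. rewrite Rmin_left by lra. intros Hz. apply continuous_Rpower. lra.
Qed.

Lemma pow_int_ge0 (g Th : R) : 1 <= Th -> 0 <= pow_int g Th.
Proof.
  intros H. apply RInt_ge_0; [exact H|now apply ex_pow_int|]. intros; left; apply Rpower_pos.
Qed.

Lemma pow_int_neq0 (g Th : R) : g <> 0 -> 1 <= Th -> pow_int g Th = (Rpower Th g - 1) / g.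
Proof.
  intros Hg H. unfold pow_int.
  assert (HI : is_RInt (fun X => Rpower X (g - 1)) 1 Th (minus (Rpower Th g / g) (Rpower 1 g / g))).
  { apply (is_RInt_derive (fun X => Rpower X g / g)); intros z; rewrite Rmin_left by lra; intros Hz.
    - replace (Rpower z (g - 1)) with (/ g * (g * Rpower z (g - 1))) by (field; exact Hg).
      apply (is_derive_ext (fun X => / g * Rpower X g)); [intros y; change (/ g * Rpower y g = Rpower y g / g); field; exact Hg|].
      apply is_derive_scal. apply is_derive_Rpower. lra.
    - apply continuous_Rpower. lra. }
  apply (@is_RInt_unique R_CompleteNormedModule) in HI. rewrite HI.
  change (Rpower Th g / g - Rpower 1 g / g = (Rpower Th g - 1) / g).
  replace (Rpower 1 g) with 1 by (unfold Rpower; now rewrite ln_1, Rmult_0_r, exp_0). field. exact Hg.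
Qed.

Lemma pow_int_pos (g Th : R) : 0 < g -> 1 <= Th -> pow_int g Th <= Rpower Th g / g.
Proof.
  intros Hg H. rewrite pow_int_neq0 by lra. unfold Rdiv. apply Rmult_le_compat_r; [|lra].
  left; now apply Rinv_0_lt_compat.
Qed.

Lemma pow_int_neg (g Th : R) : g < 0 -> 1 <= Th -> pow_int g Th <= / - g.
Proof.
  intros Hg H. rewrite pow_int_neq0 by lra.
  replace ((Rpower Th g - 1) / g) with ((1 - Rpower Th g) * / - g) by (field; lra).
  rewrite <- (Rmult_1_l (/ - g)) at 2. apply Rmult_le_compat_r.
  - left; apply Rinv_0_lt_compat; lra.
  - pose proof (Rpower_pos Th g); lra.
Qed.

Lemma pow_int_0 (Th : R) : 1 <= Th -> pow_int 0 Th = ln Th.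
Proof.
  intros H. unfold pow_int.
  assert (HI : is_RInt (fun X => Rpower X (0 - 1)) 1 Th (minus (ln Th) (ln 1))).
  { apply (is_RInt_derive ln); intros z; rewrite Rmin_left by lra; intros Hz.
    - replace (Rpower z (0 - 1)) with (/ z).
      + apply is_derive_Reals, derivable_pt_lim_ln. lra.
      + replace (0 - 1) with (- (1)) by ring. rewrite Rpower_Ropp, Rpower_1 by lra. reflexivity.
    - apply continuous_Rpower. lra. }
  apply (@is_RInt_unique R_CompleteNormedModule) in HI. rewrite HI.
  change (ln Th - ln 1 = ln Th). rewrite ln_1. ring.
Qed.

Lemma pow_int_mono (g g' Th : R) : g <= g' -> 1 <= Th -> pow_int g Th <= pow_int g' Th.
Proof.
  intros Hg H. apply RInt_le; [exact H|now apply ex_pow_int|now apply ex_pow_int|].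
  intros x Hx. apply Rle_Rpower; lra.
Qed.

Lemma RInt_three_powers (c1 c2 c3 s1 s2 s3 Th : R) : 1 <= Th ->
  RInt (fun X => c1 * Rpower X s1 + c2 * Rpower X s2 + c3 * Rpower X s3) 1 Th
  = c1 * pow_int (s1 + 1) Th + c2 * pow_int (s2 + 1) Th + c3 * pow_int (s3 + 1) Th.
Proof.
  intros H. unfold pow_int.
  replace (s1 + 1 - 1) with s1 by ring. replace (s2 + 1 - 1) with s2 by ring.
  replace (s3 + 1 - 1) with s3 by ring.
  assert (E : forall c s, is_RInt (fun X => c * Rpower X s) 1 Th (c * RInt (fun X => Rpower X s) 1 Th)).
  { intros c s. apply (@is_RInt_scal R_NormedModule (fun X => Rpower X s)).
    apply (@RInt_correct R_CompleteNormedModule). now apply ex_pow_int. }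
  apply (@is_RInt_unique R_CompleteNormedModule).
  apply (@is_RInt_plus R_NormedModule (fun X => c1 * Rpower X s1 + c2 * Rpower X s2)); [|apply E].
  apply (@is_RInt_plus R_NormedModule (fun X => c1 * Rpower X s1)); apply E.
Qed.

(** * Existence under abstract smallness conditions *)

Definition in_cone_bound (r T : R) (b : R -> R -> R) (w : R -> R -> R) : Prop :=
  forall x t, 0 <= t <= T ->
    (t + r < Rabs x -> w x t = 0) /\
    (Rabs x <= t + r -> Rabs (w x t) <= b x t).

(** Along a characteristic one of the two labels is the constant [Z] and the
    source vanishes unless the other lies between [1] and [Th]; the powers of [X]
    in [source_bound] integrate to [pow_int (1 - al) Th], at most [1], and
    [pow_int (q + 1 - p * al) Th]. *)
Lemma char_int_source_bound (p q al N eps K1 K2 mu A r T c : R) (F : R -> R -> R) :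
  1 < p -> 0 <= al -> 0 <= N -> (p - 1) * al <= q -> q + 2 <= p * N -> q + N <= p * N ->
  0 < eps -> 0 < K1 -> 0 < K2 -> 0 < mu -> 0 <= A -> 1 <= r -> 0 < T ->
  c = 1 \/ c = -1 -> cont2 F ->
  in_cone_bound r T (fun y s =>
     A * (Rpower (envelope eps K1 K2 mu N al (s - Rabs y + r + 1)) p
       * (Rpower (s + Rabs y + r + 1) (- al) * Rpower (s - Rabs y + r + 1) q))) F ->
  forall x t, 0 <= t <= T -> Rabs x <= t + r ->
  let Z := t + c * x + r + 1 in let Th := 2 * T + 2 * r + 2 in
  Rabs (char_int c F x t) <= A * Rpower (2 * eps) p *
    (Rpower K1 p * (Rpower Z (- N) * pow_int (1 - al) Th + Rpower Z (- al))
     + Rpower (K2 * mu) p * (Rpower Z (- al) * pow_int (q + 1 - p * al) Th)).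
Proof.
  intros Hp Ha HN Hq HN2 HNN He H1 H2 Hm HA Hr HT Hc HF HFb x t Ht Hx Z Th.
  assert (HTh : 1 <= Th) by (unfold Th; lra).
  assert (HZ : 1 <= Z).
  { unfold Z. apply Rabs_le_between in Hx. destruct Hc as [-> | ->]; lra. }
  set (B := A * Rpower (2 * eps) p).
  assert (HB : 0 <= B) by (apply Rmult_le_pos; [exact HA|left; apply Rpower_pos]).
  pose proof (Rpower_pos K1 p) as HP1. pose proof (Rpower_pos (K2 * mu) p) as HP2.
  pose proof (Rpower_pos Z (- N)) as HZN. pose proof (Rpower_pos Z (- al)) as HZa.
  set (c1 := B * (Rpower K1 p * Rpower Z (- N))).
  set (c2 := B * (Rpower K1 p * Rpower Z (- al))).
  set (c3 := B * (Rpower (K2 * mu) p * Rpower Z (- al))).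
  assert (Hc1 : 0 <= c1) by (apply Rmult_le_pos; [exact HB|nra]).
  assert (Hc2 : 0 <= c2) by (apply Rmult_le_pos; [exact HB|nra]).
  assert (Hc3 : 0 <= c3) by (apply Rmult_le_pos; [exact HB|nra]).
  set (h := fun X => c1 * Rpower X (- al) + c2 * Rpower X (- 2) + c3 * Rpower X (q + 1 - p * al - 1)).
  (* one label is constant on the characteristic, the other has slope 2 *)
  assert (Hpos : forall s, 0 <= s <= t -> let y := x + c * (t - s) in
    s + c * y + r + 1 = Z /\ s - c * y + r + 1 = 2 * s + (r + 1 - t - c * x)).
  { intros s Hs y. unfold Z, y. destruct Hc as [-> | ->]; lra. }
  assert (Hmm : forall s, 0 <= s <= t -> let y := x + c * (t - s) in
    let X := 2 * s + (r + 1 - t - c * x) in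
    s - Rabs y + r + 1 = Rmin X Z /\ s + Rabs y + r + 1 = Rmax X Z).
  { intros s Hs y X. destruct (Hpos s Hs) as [e1 e2]. fold y in e1, e2.
    unfold X. rewrite <- e1, <- e2.
    unfold Rmin, Rmax. destruct Rle_dec; unfold Rabs; destruct Rcase_abs;
      destruct Hc as [-> | ->]; lra. }
  assert (HR : Rabs (char_int c F x t) <= RInt h 1 Th).
  { unfold char_int.
    apply (line_integral_bound (fun s => F (x + c * (t - s)) s) h (r + 1 - t - c * x)).
    - lra.
    - intros s. now apply char_int_integrand_cont.
    - intros X HX. unfold h.
      assert (E : forall k s, continuous (fun X => k * Rpower X s) X).
      { intros k s. apply (@continuous_mult _ R_AbsRing (fun _ => k)); [apply continuous_const|].
        apply continuous_Rpower. lra. }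
      apply (@continuous_plus _ R_AbsRing R_NormedModule); [|apply E].
      apply (@continuous_plus _ R_AbsRing R_NormedModule); apply E.
    - intros X HX. unfold h. pose proof (Rpower_pos X (- al)). pose proof (Rpower_pos X (- 2)).
      pose proof (Rpower_pos X (q + 1 - p * al - 1)).
      repeat apply Rplus_le_le_0_compat; apply Rmult_le_pos; lra.
    - intros s Hs HX. destruct (Hmm s Hs) as [e1 e2].
      apply HFb; [lra|]. assert (Rmin (2 * s + (r + 1 - t - c * x)) Z < 1).
      { eapply Rle_lt_trans; [apply Rmin_l|exact HX]. }
      lra.
    - intros s Hs HX. destruct (Hmm s Hs) as [e1 e2].
      set (y := x + c * (t - s)) in *. set (X := 2 * s + (r + 1 - t - c * x)) in *.
      assert (1 <= Rmin X Z) by (now apply Rmin_glb).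
      destruct (HFb y s ltac:(lra)) as [_ Hb].
      eapply Rle_trans; [apply Hb; lra|]. rewrite e1, e2.
      eapply Rle_trans; [apply Rmult_le_compat_l; [exact HA|]; apply source_bound; assumption|].
      right. unfold h, c1, c2, c3, B. ring.
    - exact HTh.
    - unfold Th. apply Rabs_le_between in Hx. destruct Hc as [-> | ->]; lra. }
  eapply Rle_trans; [exact HR|]. unfold h. rewrite RInt_three_powers by exact HTh.
  replace (- al + 1) with (1 - al) by ring. replace (q + 1 - p * al - 1 + 1) with (q + 1 - p * al) by ring.
  assert (Hm1 : pow_int (- 2 + 1) Th <= 1).
  { replace 1 with (/ - (- 2 + 1)) at 2 by field. apply pow_int_neg; lra. }
  assert (Hle : c2 * pow_int (- 2 + 1) Th <= c2) by nra.
  apply Rle_trans with (c1 * pow_int (1 - al) Th + c2 + c3 * pow_int (q + 1 - p * al) Th); [lra|].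
  right. unfold c1, c2, c3, B. ring.
Qed.

Lemma Rpower_eps_split (lam eps p : R) : 0 < eps ->
  lam * Rpower (2 * eps) p = Rpower 2 p * (eps * (lam * Rpower eps (p - 1))).
Proof.
  intros He. rewrite Rpower_mult_base by lra.
  replace (Rpower eps p) with (eps * Rpower eps (p - 1)); [ring|].
  rewrite <- (Rpower_1 eps) at 1 by exact He. rewrite <- Rpower_plus. f_equal. ring.
Qed.

(** Half of [K1] is used up by the data and half by the near-cone source; half of
    [K2] by what is collected near the cone and half by the interior source. *)
Lemma duhamel_preserves_envelope
  (p q al N eps K0 K1 K2 lam Cw r T : R) (k l : R -> R) (W v : R -> R -> R) :
  let mu := lam * Rpower eps (p - 1) in
  let Th := 2 * T + 2 * r + 2 in
  let phi := envelope eps K1 K2 mu N al in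
  1 < p -> 0 <= al -> 0 <= N -> (p - 1) * al <= q -> q + 2 <= p * N -> q + N <= p * N ->
  0 < eps -> 0 < K0 -> 0 < K1 -> 0 < K2 -> 0 < lam -> 0 < Cw -> 1 <= r -> 0 < T ->
  K0 * Rpower (2 * r + 1) N <= K1 / 2 ->
  Cw * Rpower 2 p * Rpower K1 p * (mu * pow_int (1 - al) Th) <= K1 / 2 ->
  2 * (Cw * Rpower 2 p * Rpower K1 p) <= K2 ->
  Cw * Rpower 2 p * Rpower K2 p * (Rpower mu p * pow_int (q + 1 - p * al) Th) <= K2 / 2 ->
  phi 1 <= 1 ->
  (forall z, (r < Rabs z -> k z = 0) /\ Rabs (k z) <= eps * K0) ->
  (forall z, (r < Rabs z -> l z = 0) /\ Rabs (l z) <= eps * K0) ->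
  cont2 W ->
  (forall x t, 0 <= t <= T -> Rabs x <= t + r -> Rabs (W x t) <= Cw * lam *
     (Rpower (t + Rabs x + r + 1) (- al) * Rpower (t - Rabs x + r + 1) q)) ->
  cont2 v ->
  in_cone_bound r T (fun x t => phi (t - Rabs x + r + 1)) v ->
  in_cone_bound r T (fun x t => phi (t - Rabs x + r + 1))
    (fun x t => dalembert k l x t + duhamel (fun x t => trunc_pow p (v x t) * W x t) x t).
Proof.
  intros mu Th phi Hp Ha HN Hq HN2 HNN He HK0 HK1 HK2 Hlam HCw Hr HT C0 C1 C2 C3 Hphi1 Hk Hl HW HWb Hv Hvb.
  assert (Hmu : 0 < mu) by (apply Rmult_lt_0_compat; [exact Hlam|apply Rpower_pos]).
  assert (HTh : 1 <= Th) by (unfold Th; lra).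
  set (F := fun x t => trunc_pow p (v x t) * W x t).
  assert (Hphi_pos : forall y, 0 < phi y) by (intros; now apply envelope_pos).
  assert (Hphi_anti : forall y z, 0 < y -> y <= z -> phi z <= phi y)
    by (intros; now apply envelope_anti).
  assert (HF : cont2 F).
  { apply cont2_mult; [|exact HW]. apply cont2_app; [|exact Hv].
    apply (C1_continuous _ (dtrunc_pow p)). intros; now apply is_derive_trunc_pow. }
  assert (HFb : in_cone_bound r T (fun y s =>
     Cw * lam * (Rpower (phi (s - Rabs y + r + 1)) p
       * (Rpower (s + Rabs y + r + 1) (- al) * Rpower (s - Rabs y + r + 1) q))) F).
  { intros y s Hs. destruct (Hvb y s Hs) as [Hout Hin]. unfold F. split; intros Hys.
    - rewrite Hout by exact Hys. rewrite trunc_pow_eq, abs_pow_0; [ring|exact Hp|rewrite Rabs_R0; lra].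
    - specialize (Hin Hys). specialize (HWb y s Hs Hys).
      assert (Hv1 : Rabs (v y s) <= 1).
      { eapply Rle_trans; [exact Hin|]. eapply Rle_trans; [apply (Hphi_anti 1); lra|exact Hphi1]. }
      rewrite trunc_pow_eq by assumption. rewrite Rabs_mult, Rabs_right by (apply Rle_ge, abs_pow_ge0).
      eapply Rle_trans; [apply Rmult_le_compat; [apply abs_pow_ge0|apply Rabs_pos| |exact HWb]|].
      + apply abs_pow_le; [lra|apply Hphi_pos|exact Hin].
      + right; ring. }
  assert (Hchar : forall c x t, c = 1 \/ c = -1 -> 0 <= t <= T -> Rabs x <= t + r ->
     let Z := t + c * x + r + 1 in
     Rabs (char_int c F x t) <= phi Z - eps * (K1 / 2) * Rpower Z (- N)).
  { intros c x t Hc Ht Hx Z.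
    assert (HA : 0 <= Cw * lam) by (apply Rmult_le_pos; lra).
    eapply Rle_trans.
    { apply (char_int_source_bound p q al N eps K1 K2 mu (Cw * lam) r T c F); assumption. }
    fold Th. fold Z.
    replace (Cw * lam * Rpower (2 * eps) p) with (Cw * Rpower 2 p * (eps * mu)).
    2:{ unfold mu. rewrite (Rmult_assoc Cw lam), Rpower_eps_split by exact He. ring. }
    rewrite (Rpower_mult_base K2 mu) by assumption.
    pose proof (Rpower_pos Z (- N)) as HZN. pose proof (Rpower_pos Z (- al)) as HZa.
    set (I1 := pow_int (1 - al) Th) in *. set (I2 := pow_int (q + 1 - p * al) Th) in *.
    apply Rle_trans with
      (eps * Rpower Z (- N) * (Cw * Rpower 2 p * Rpower K1 p * (mu * I1))
       + eps * mu * Rpower Z (- al) * (Cw * Rpower 2 p * Rpower K1 p)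
       + eps * mu * Rpower Z (- al) * (Cw * Rpower 2 p * Rpower K2 p * (Rpower mu p * I2))); [right; ring|].
    apply Rle_trans with (eps * Rpower Z (- N) * (K1 / 2) + eps * mu * Rpower Z (- al) * (K2 / 2)
       + eps * mu * Rpower Z (- al) * (K2 / 2)); [|right; unfold phi, envelope; field].
    assert (0 < eps * Rpower Z (- N)) by now apply Rmult_lt_0_compat.
    assert (0 < eps * mu * Rpower Z (- al)) by exact (Rmult_lt_0_compat _ _ (Rmult_lt_0_compat _ _ He Hmu) HZa).
    apply Rplus_le_compat; [apply Rplus_le_compat|]; apply Rmult_le_compat_l; lra. }
  assert (Hdata : forall (d : R -> R) z, (forall z, (r < Rabs z -> d z = 0) /\ Rabs (d z) <= eps * K0) ->
     forall Z, 1 <= Z -> Rabs z = Rabs (Z - r - 1) -> Rabs (d z) <= eps * (K1 / 2) * Rpower Z (- N)).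
  { intros d z Hd Z HZ HzZ. destruct (Hd z) as [Hd0 Hdb].
    pose proof (Rpower_pos Z (- N)) as HZN.
    destruct (Rlt_dec r (Rabs z)) as [Hrz|Hrz].
    - rewrite Hd0 by exact Hrz. rewrite Rabs_R0. repeat apply Rmult_le_pos; lra.
    - assert (HZr : Z <= 2 * r + 1).
      { rewrite HzZ in Hrz. pose proof (Rle_abs (Z - r - 1)). lra. }
      assert (HZ1 : 1 <= Rpower (2 * r + 1) N * Rpower Z (- N)).
      { rewrite Rpower_Ropp. pose proof (Rpower_pos Z N).
        apply (Rmult_le_reg_r (Rpower Z N)); [assumption|].
        rewrite Rmult_assoc, Rinv_l, Rmult_1_l, Rmult_1_r by lra. apply Rle_Rpower_l; lra. }
      eapply Rle_trans; [exact Hdb|].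
      rewrite Rmult_assoc. apply Rmult_le_compat_l; [lra|].
      apply Rle_trans with (K0 * Rpower (2 * r + 1) N * Rpower Z (- N)).
      + rewrite Rmult_assoc. rewrite <- (Rmult_1_r K0) at 1. apply Rmult_le_compat_l; lra.
      + apply Rmult_le_compat_r; lra. }
  intros x t Ht. split; intros Hx.
  - assert (Hz1 : k (x + t) = 0).
    { apply Hk. revert Hx. unfold Rabs. repeat destruct Rcase_abs; lra. }
    assert (Hz2 : l (x - t) = 0).
    { apply Hl. revert Hx. unfold Rabs. repeat destruct Rcase_abs; lra. }
    assert (Hz3 : forall c, c = 1 \/ c = -1 -> char_int c F x t = 0).
    { intros c Hc. unfold char_int. rewrite (RInt_ext _ (fun _ => 0)).
      - rewrite RInt_const. unfold scal; simpl; unfold mult; simpl. ring.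
      - intros s. rewrite Rmin_left, Rmax_right by lra. intros Hs.
        apply HFb; [lra|]. revert Hx. destruct Hc as [-> | ->]; unfold Rabs; repeat destruct Rcase_abs; lra. }
    change (dalembert k l x t + duhamel F x t = 0). unfold dalembert, duhamel.
    rewrite Hz1, Hz2, !Hz3 by tauto. field.
  - assert (Hx' := proj1 (Rabs_le_between _ _) Hx).
    set (X := t + 1 * x + r + 1). set (Y := t + -1 * x + r + 1).
    assert (HA1 := Hchar 1 x t ltac:(tauto) Ht Hx). assert (HB1 := Hchar (-1) x t ltac:(tauto) Ht Hx).
    fold X in HA1. fold Y in HB1. cbv zeta in HA1, HB1.
    assert (Hk1 : Rabs (k (x + t)) <= eps * (K1 / 2) * Rpower X (- N)).
    { apply Hdata; [exact Hk|unfold X; lra|]. f_equal. unfold X. ring. }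
    assert (Hl1 : Rabs (l (x - t)) <= eps * (K1 / 2) * Rpower Y (- N)).
    { apply Hdata; [exact Hl|unfold Y; lra|]. rewrite <- Rabs_Ropp. f_equal. unfold Y. ring. }
    set (m := t - Rabs x + r + 1).
    assert (HX : phi X <= phi m).
    { apply Hphi_anti; unfold m, X; [lra|]. unfold Rabs; destruct Rcase_abs; lra. }
    assert (HY : phi Y <= phi m).
    { apply Hphi_anti; unfold m, Y; [lra|]. unfold Rabs; destruct Rcase_abs; lra. }
    change (Rabs (dalembert k l x t + duhamel F x t) <= phi m). unfold dalembert, duhamel.
    apply Rabs_le_between in HA1. apply Rabs_le_between in HB1.
    apply Rabs_le_between in Hk1. apply Rabs_le_between in Hl1.
    apply Rabs_le_between. split; lra.
Qed.

Lemma in_cone_bound_lim (r T : R) (b : R -> R -> R) (w : nat -> R -> R -> R) (v : R -> R -> R) :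
  (forall n, in_cone_bound r T b (w n)) ->
  (forall x t, is_lim_seq (fun n => w n x t) (v x t)) -> in_cone_bound r T b v.
Proof.
  intros H Hl x t Ht. split; intros Hx.
  - assert (H0 : is_lim_seq (fun n => w n x t) 0).
    { apply is_lim_seq_ext with (fun _ => 0); [|apply is_lim_seq_const].
      intros n. symmetry. now apply H. }
    specialize (Hl x t). apply is_lim_seq_unique in H0. apply is_lim_seq_unique in Hl.
    rewrite Hl in H0. now injection H0.
  - specialize (Hl x t). apply is_lim_seq_abs in Hl. simpl in Hl.
    refine (is_lim_seq_le _ (fun _ => b x t) _ _ _ Hl (is_lim_seq_const _)).
    intros n. now apply H.
Qed.

(** The constants are chosen in the order [N], [K1], [K2], [dl]: [K1] from the
    data, [K2] from the amount that a wave of size [K1] emits into the interior,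
    and [dl] last.  The induction over the Picard iterates then closes, and the
    limit stays in the range where [trunc_pow] is the power itself. *)
Theorem small_data_existence (p a b r al q K0 : R) :
  1 < p -> 1 <= r -> 0 <= al -> (p - 1) * al <= q -> 0 < K0 ->
  exists dl, 0 < dl /\ forall eps lam T, 0 < eps <= dl -> 0 < lam -> 0 < T ->
  let mu := lam * Rpower eps (p - 1) in
  let Th := 2 * T + 2 * r + 2 in
  (forall M m, 1 <= m -> m <= M -> M <= Th ->
    Rpower M (- (1 + a)) * Rpower m (- (1 + b)) <= lam * (Rpower M (- al) * Rpower m q)) ->
  mu <= 1 -> mu * pow_int (1 - al) Th <= dl ->
  Rpower mu p * pow_int (q + 1 - p * al) Th <= dl ->
  forall u0 u1 d1 d2 e1 : R -> R,
  (forall z, is_derive u0 z (d1 z)) -> (forall z, is_derive d1 z (d2 z)) ->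
  (forall z, is_derive u1 z (e1 z)) ->
  (forall z, continuous d2 z) -> (forall z, continuous e1 z) ->
  (forall z, r < Rabs z -> u1 z = 0 /\ d1 z = 0) ->
  (forall z, Rabs (u1 z) + Rabs (d1 z) <= eps * K0) ->
  exists u, classical_solution p a b u0 u1 T u.
Proof.
  intros Hp Hr Ha Hq HK0.
  assert (Hq0 : 0 <= q) by (eapply Rle_trans; [|exact Hq]; apply Rmult_le_pos; lra).
  (* q + N = p N - 2 and q + 2 <= p N, as the estimate of the source asks *)
  set (N := (q + 2) / (p - 1)).
  assert (HNp : (p - 1) * N = q + 2) by (unfold N; field; lra).
  assert (HN : 0 <= N) by (apply Rdiv_le_0_compat; lra).
  set (Cw := Rpower (2 * (r + 2)) (Rabs (1 + a)) * Rpower (2 * (r + 2)) (Rabs (1 + b))).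
  assert (HCw : 0 < Cw) by (apply Rmult_lt_0_compat; apply Rpower_pos).
  set (K1 := 2 * (K0 * Rpower (2 * r + 1) N)).
  assert (HK1 : 0 < K1).
  { apply Rmult_lt_0_compat; [lra|]. apply Rmult_lt_0_compat; [exact HK0|apply Rpower_pos]. }
  set (Q1 := Cw * Rpower 2 p * Rpower K1 p).
  assert (HQ1 : 0 < Q1) by (repeat apply Rmult_lt_0_compat; try exact HCw; apply Rpower_pos).
  set (K2 := 2 * Q1). assert (HK2 : 0 < K2) by (unfold K2; lra).
  set (Q2 := Cw * Rpower 2 p * Rpower K2 p).
  assert (HQ2 : 0 < Q2) by (repeat apply Rmult_lt_0_compat; try exact HCw; apply Rpower_pos).
  set (dl := Rmin (/ (K1 + K2)) (Rmin (K1 / 2 / Q1) (K2 / 2 / Q2))).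
  assert (Hdl1 : dl <= / (K1 + K2)) by apply Rmin_l.
  assert (Hdl2 : dl <= K1 / 2 / Q1) by (eapply Rle_trans; [apply Rmin_r|apply Rmin_l]).
  assert (Hdl3 : dl <= K2 / 2 / Q2) by (eapply Rle_trans; [apply Rmin_r|apply Rmin_r]).
  exists dl. split.
  { unfold dl. repeat apply Rmin_pos; [apply Rinv_0_lt_compat; lra| |]; apply Rdiv_lt_0_compat; lra. }
  intros eps lam T [He Hedl] Hlam HT mu Th Hweight Hmu1 HJ1 HJ2 u0 u1 d1 d2 e1 Du0 Dd1 Du1 Cd2 Ce1 Hsupp Hsize.
  assert (Hmu : 0 < mu) by (apply Rmult_lt_0_compat; [exact Hlam|apply Rpower_pos]).
  set (k := fun z => u1 z + d1 z). set (l := fun z => u1 z - d1 z).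
  set (phi := envelope eps K1 K2 mu N al).
  destruct (C1x_weight a b) as [Wx HWx].
  assert (HcW : cont2 (weight a b)) by apply HWx.
  assert (Hdata : C1x (dalembert k l) (dalembert (fun z => e1 z + d2 z) (fun z => e1 z - d2 z))).
  { apply C1x_dalembert; intros z.
    - apply (@is_derive_plus R_AbsRing R_NormedModule); [apply Du1|apply Dd1].
    - apply (@is_derive_minus R_AbsRing R_NormedModule); [apply Du1|apply Dd1].
    - apply (@continuous_plus _ R_AbsRing R_NormedModule); [apply Ce1|apply Cd2].
    - apply (@continuous_minus _ R_AbsRing R_NormedModule); [apply Ce1|apply Cd2]. }
  assert (HcN : forall z, continuous (trunc_pow p) z).
  { apply (C1_continuous _ (dtrunc_pow p)). intros; now apply is_derive_trunc_pow. }
  set (G := fun x t z => trunc_pow p z * weight a b x t).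
  assert (HG : cont_comp G).
  { intros w Hw. unfold G. apply cont2_mult; [now apply cont2_app|exact HcW]. }
  assert (HGL : loc_lipschitz G).
  { intros L. destruct (cont2_bounded _ L HcW) as [B [HB0 HB]].
    exists (p * (B + 1)). split; [apply Rmult_lt_0_compat; lra|]. intros x t y z Hxt.
    apply diamond_coord in Hxt. specialize (HB x t (proj1 Hxt) (proj2 Hxt)).
    unfold G. rewrite <- Rmult_minus_distr_r.
    destruct (mean_value (trunc_pow p) (dtrunc_pow p) z y) as [c [_ Hc]].
    { intros; now apply is_derive_trunc_pow. }
    rewrite Hc, !Rabs_mult. pose proof (dtrunc_pow_bound p c Hp).
    pose proof (Rabs_pos (y - z)). pose proof (Rabs_pos (dtrunc_pow p c)).
    apply Rle_trans with (p * Rabs (y - z) * B); [|nra].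
    apply Rmult_le_compat; try lra; [|apply Rabs_pos|]; nra. }
  destruct (volterra (dalembert k l) G) as [v [Hv [Hveq Hvlim]]];
    [apply Hdata|exact HG|exact HGL|].
  assert (Hphi1 : phi 1 <= 1).
  { unfold phi, envelope.
    assert (H1 : forall s, Rpower 1 s = 1) by (intros; unfold Rpower; now rewrite ln_1, Rmult_0_r, exp_0).
    rewrite !H1, !Rmult_1_r.
    apply Rle_trans with (dl * (K1 + K2)).
    - apply Rmult_le_compat; try lra; nra.
    - apply Rle_trans with (/ (K1 + K2) * (K1 + K2)); [|right; field; lra].
      apply Rmult_le_compat_r; lra. }
  assert (Hb : in_cone_bound r T (fun x t => phi (t - Rabs x + r + 1)) v).
  { apply (in_cone_bound_lim _ _ _ (picard (dalembert k l) G)); [|exact Hvlim].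
    induction n as [|n IH].
    - intros x t _. split; intros _; [reflexivity|]. simpl. rewrite Rabs_R0.
      left; now apply envelope_pos.
    - simpl. apply (duhamel_preserves_envelope p q al N eps K0 K1 K2 lam Cw); try assumption.
      + lra.
      + lra.
      + unfold K1; lra.
      + fold mu Th Q1. apply Rle_trans with (Q1 * (K1 / 2 / Q1)); [|right; field; lra].
        apply Rmult_le_compat_l; lra.
      + fold Q1. unfold K2; lra.
      + fold mu Th Q2. apply Rle_trans with (Q2 * (K2 / 2 / Q2)); [|right; field; lra].
        apply Rmult_le_compat_l; lra.
      + intros z. split; intros; unfold k.
        * destruct (Hsupp z ltac:(assumption)) as [-> ->]. ring.
        * eapply Rle_trans; [apply Rabs_triang|apply Hsize].
      + intros z. split; intros; unfold l.
        * destruct (Hsupp z ltac:(assumption)) as [-> ->]. ring.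
        * unfold Rminus. eapply Rle_trans; [apply Rabs_triang|]. rewrite Rabs_Ropp. apply Hsize.
      + intros x t Ht Hx. rewrite Rabs_right by (left; apply weight_pos).
        eapply Rle_trans; [apply (weight_bound a b r x t); lra|]. fold Cw.
        rewrite Rmult_assoc. apply Rmult_le_compat_l; [lra|].
        pose proof (Rabs_pos x). apply Hweight; unfold Th; lra.
      + now apply cont2_picard; [apply Hdata|]. }
  assert (Hv1 : forall x t, 0 <= t <= T -> Rabs (v x t) <= 1).
  { intros x t Ht. destruct (Hb x t Ht) as [Hout Hin].
    destruct (Rle_dec (Rabs x) (t + r)) as [Hx|Hx].
    - eapply Rle_trans; [now apply Hin|]. eapply Rle_trans; [|exact Hphi1].
      apply envelope_anti; try assumption; lra.
    - rewrite Hout by lra. rewrite Rabs_R0. lra. }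
  destruct (volterra_C1 (trunc_pow p) (dtrunc_pow p) p (weight a b) Wx (dalembert k l)
     (dalembert (fun z => e1 z + d2 z) (fun z => e1 z - d2 z)) v) as [w Hw]; try assumption.
  { intros; now apply is_derive_trunc_pow. } { intros; now apply continuous_dtrunc_pow. } { lra. }
  { intros; now apply dtrunc_pow_bound. }
  set (F := fun x t => trunc_pow p (v x t) * weight a b x t).
  assert (HF : exists Fx, C1x F Fx).
  { destruct Hw as [_ [Hcw Dw]]. destruct HWx as [_ [HcWx DW]].
    exists (fun x t => w x t * dtrunc_pow p (v x t) * weight a b x t + trunc_pow p (v x t) * Wx x t).
    assert (Ht : cont2 (fun x t => trunc_pow p (v x t))) by now apply cont2_app.
    split; [|split].
    - now apply cont2_mult.
    - apply cont2_plus; apply cont2_mult; try assumption. apply cont2_mult; [exact Hcw|].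
      apply cont2_app; [|exact Hv]. intros; now apply continuous_dtrunc_pow.
    - intros x t. apply (is_derive_mult (fun x => trunc_pow p (v x t)) (fun x => weight a b x t)).
      + apply (is_derive_comp (trunc_pow p) (fun x => v x t)); [now apply is_derive_trunc_pow|apply Dw].
      + apply DW.
      + intros; apply Rmult_comm. }
  destruct HF as [Fx HF].
  destruct (wave_of_velocity T u0 u1 d1 d2 e1 v F Fx) as
    (u & ux & uxx & uxt & utx & utt & HC2 & Heq & Hu0 & Hu1); try assumption.
  exists u, ux, v, uxx, uxt, utx, utt. split; [exact HC2|]. split; [|now split].
  intros x t Ht. rewrite Heq. unfold F.
  rewrite trunc_pow_eq; [|exact Hp|now apply Hv1]. now rewrite weight_eq.
Qed.

(** * The five regimes *)

Lemma supp_outside (h : R -> R) (r z : R) :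
  included (supp h) (fun x => Rabs x <= r) -> r < Rabs z -> h z = 0.
Proof.
  intros H Hz. destruct (Req_dec (h z) 0) as [E|E]; [exact E|]. exfalso.
  assert (Rabs z <= r) by (apply H, (adherence_P1 (fun x => h x <> 0)); exact E). lra.
Qed.

Lemma Derive_outside (h : R -> R) (r z : R) :
  included (supp h) (fun x => Rabs x <= r) -> r < Rabs z -> Derive h z = 0.
Proof.
  intros H Hz. rewrite (Derive_ext_loc h (fun _ => 0)); [apply Derive_const|].
  assert (Hd : 0 < Rabs z - r) by lra. exists (mkposreal _ Hd). intros y Hy.
  apply (supp_outside h r); [exact H|]. change (Rabs (y - z) < Rabs z - r) in Hy.
  pose proof (Rabs_triang_inv z y). rewrite Rabs_minus_sym in Hy. lra.
Qed.

Lemma bounded_of_outside (h : R -> R) (r : R) :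
  (forall z, continuous h z) -> (forall z, r < Rabs z -> h z = 0) ->
  exists B, 0 <= B /\ forall z, Rabs (h z) <= B.
Proof.
  intros Hc H0. destruct (cont2_bounded (fun x _ => h x) (Rabs r)) as [B [HB0 HB]].
  { apply (cont2_app h (fun x t => x)); [exact Hc|apply cont2_fst]. }
  exists B. split; [exact HB0|]. intros z. destruct (Rlt_dec r (Rabs z)) as [Hz|Hz].
  - rewrite H0, Rabs_R0 by exact Hz. exact HB0.
  - apply (HB z 0); [|rewrite Rabs_R0; apply Rabs_pos]. pose proof (Rle_abs r). lra.
Qed.

(** The conclusion of [small_data_existence] for the data of the problem, for a
    weight dominated by [lam M^(-al) m^q] and the smallness constant [dl]. *)
Definition solvable_with (p a b r : R) (f g : R -> R) (al q dl : R) : Prop :=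
  forall eps lam T, 0 < eps <= dl -> 0 < lam -> 0 < T ->
  let mu := lam * Rpower eps (p - 1) in
  let Th := 2 * T + 2 * r + 2 in
  (forall M m, 1 <= m -> m <= M -> M <= Th ->
    Rpower M (- (1 + a)) * Rpower m (- (1 + b)) <= lam * (Rpower M (- al) * Rpower m q)) ->
  mu <= 1 -> mu * pow_int (1 - al) Th <= dl ->
  Rpower mu p * pow_int (q + 1 - p * al) Th <= dl ->
  exists u, classical_solution p a b (fun x => eps * f x) (fun x => eps * g x) T u.

Lemma solvable (p a b r : R) (f g : R -> R) (al q : R) :
  1 < p -> 1 <= r -> C0k 2 f -> C0k 1 g ->
  included (supp f) (fun x => Rabs x <= r) ->
  included (supp g) (fun x => Rabs x <= r) ->
  0 <= al -> (p - 1) * al <= q ->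
  exists dl, 0 < dl /\ solvable_with p a b r f g al q dl.
Proof.
  intros Hp Hr [Hf _] [Hg _] Hsf Hsg Hal Hq.
  assert (Df : forall z, is_derive f z (Derive f z)).
  { intros z. apply Derive_correct. apply (Hf 1%nat z). lia. }
  assert (Ddf : forall z, is_derive (Derive f) z (Derive_n f 2 z)).
  { intros z. apply (Derive_correct (Derive_n f 1)). apply (Hf 2%nat z). lia. }
  assert (Dg : forall z, is_derive g z (Derive g z)).
  { intros z. apply Derive_correct. apply (Hg 1%nat z). lia. }
  assert (Cd2 : forall z, continuous (Derive_n f 2) z) by (intros z; apply (Hf 2%nat z); lia).
  assert (Ce1 : forall z, continuous (Derive g) z) by (intros z; apply (Hg 1%nat z); lia).
  assert (Cd1 : forall z, continuous (Derive f) z) by (intros z; apply (Hf 1%nat z); lia).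
  assert (Cg : forall z, continuous g z) by (intros z; apply (Hg 0%nat z); lia).
  destruct (bounded_of_outside g r Cg) as [B1 [HB10 HB1]].
  { intros; now apply (supp_outside g r). }
  destruct (bounded_of_outside (Derive f) r Cd1) as [B2 [HB20 HB2]].
  { intros; now apply (Derive_outside f r). }
  destruct (small_data_existence p a b r al q (B1 + B2 + 1)) as [dl [Hdl H]];
    try assumption; [lra|].
  exists dl. split; [exact Hdl|]. intros eps lam T He Hlam HT mu Th Hw Hmu HJ1 HJ2.
  apply (H eps lam T He Hlam HT Hw Hmu HJ1 HJ2 _ _ (fun z => eps * Derive f z)
    (fun z => eps * Derive_n f 2 z) (fun z => eps * Derive g z)).
  - intros z. apply is_derive_scal, Df.
  - intros z. apply is_derive_scal, Ddf.
  - intros z. apply is_derive_scal, Dg.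
  - intros z. apply (@continuous_mult _ R_AbsRing (fun _ => eps)); [apply continuous_const|apply Cd2].
  - intros z. apply (@continuous_mult _ R_AbsRing (fun _ => eps)); [apply continuous_const|apply Ce1].
  - intros z Hz. rewrite (supp_outside g r), (Derive_outside f r) by assumption. split; ring.
  - intros z. rewrite !Rabs_mult, (Rabs_right eps) by lra. specialize (HB1 z). specialize (HB2 z).
    rewrite <- Rmult_plus_distr_l. apply Rmult_le_compat_l; lra.
Qed.

Lemma Rpower_small (s e : R) : 0 < s -> 0 < e ->
  exists e1, 0 < e1 /\ forall x, 0 < x <= e1 -> Rpower x s <= e.
Proof.
  intros Hs He. exists (Rpower e (/ s)). split; [apply Rpower_pos|]. intros x Hx.
  apply Rle_trans with (Rpower (Rpower e (/ s)) s); [apply Rle_Rpower_l; lra|].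
  rewrite Rpower_mult. replace (/ s * s) with 1 by (field; lra). rewrite Rpower_1; lra.
Qed.

Lemma Rpower_le_self (x p : R) : 0 < x <= 1 -> 1 <= p -> Rpower x p <= x.
Proof.
  intros Hx Hp. rewrite <- (Rpower_1 x) at 2 by lra.
  replace p with (1 + (p - 1)) by ring. rewrite Rpower_plus.
  assert (H1 : Rpower x (p - 1) <= 1).
  { replace 1 with (Rpower 1 (p - 1)) at 2
      by (unfold Rpower; now rewrite ln_1, Rmult_0_r, exp_0). apply Rle_Rpower_l; lra. }
  rewrite Rpower_1 by lra. apply Rle_trans with (x * 1); [apply Rmult_le_compat_l; lra|lra].
Qed.

Lemma weight_exponent_le (a b q M m : R) :
  - (1 + b) <= q -> 1 <= m -> m <= M ->
  Rpower M (- (1 + a)) * Rpower m (- (1 + b)) <= 1 * (Rpower M (- (1 + a)) * Rpower m q).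
Proof.
  intros Hq Hm HM. rewrite Rmult_1_l. apply Rmult_le_compat_l; [left; apply Rpower_pos|].
  now apply Rle_Rpower.
Qed.

(** The exponents [s] and [- s] cancel in [eps^s ln T]; the remaining part of the
    logarithm is bounded and is absorbed by the smallness of [eps]. *)
Lemma exponential_time (s dl r : R) : 0 < s -> 0 < dl -> 1 <= r ->
  exists e1 c, 0 < e1 /\ 0 < c /\ forall eps T, 0 < eps <= e1 -> 0 < T ->
    T <= exp (c * Rpower eps (- s)) -> Rpower eps s * ln (2 * T + 2 * r + 2) <= dl.
Proof.
  intros Hs Hdl Hr. set (D := 2 * r + 4).
  assert (HlnD : 0 < ln D) by (rewrite <- ln_1; apply ln_increasing; unfold D; lra).
  destruct (Rpower_small s (dl / 2 / ln D)) as [e1 [He1 Hsm]];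
    [exact Hs|repeat apply Rdiv_lt_0_compat; lra|].
  exists e1, (dl / 2). split; [exact He1|]. split; [lra|]. intros eps T He HT HTle.
  specialize (Hsm eps He). pose proof (Rpower_pos eps s). 
  set (Y := dl / 2 * Rpower eps (- s)) in *.
  assert (HY : 0 <= Y) by (apply Rmult_le_pos; [lra|left; apply Rpower_pos]).
  assert (HE : 1 <= exp Y) by (rewrite <- exp_0; now apply exp_mono).
  assert (Hln : ln (2 * T + 2 * r + 2) <= ln D + Y).
  { rewrite <- (ln_exp Y), <- ln_mult by (unfold D; try apply exp_pos; lra).
    apply ln_le; [lra|]. unfold D. nra. }
  apply Rle_trans with (Rpower eps s * (ln D + Y)); [apply Rmult_le_compat_l; lra|].
  rewrite Rmult_plus_distr_l.
  replace (Rpower eps s * Y) with (dl / 2).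
  2:{ unfold Y. rewrite Rpower_Ropp. field. lra. }
  apply Rle_trans with (dl / 2 / ln D * ln D + dl / 2); [|right; field; lra].
  apply Rplus_le_compat_r, Rmult_le_compat_r; lra.
Qed.

(** For [T > 1] the powers of [eps] cancel and [c] makes the product small; for
    [T <= 1] the smallness of [eps] does. *)
Lemma polynomial_time (s s0 eta r : R) : 0 < s -> 0 < s0 -> 0 < eta -> 1 <= r ->
  exists e1 c, 0 < e1 /\ 0 < c /\ forall eps T, 0 < eps <= e1 -> 0 < T ->
    T <= c * Rpower eps (- s / s0) -> Rpower eps s * Rpower (2 * T + 2 * r + 2) s0 <= eta.
Proof.
  intros Hs Hs0 Heta Hr. set (D := 2 * r + 4). assert (HD : 0 < D) by (unfold D; lra).
  pose proof (Rpower_pos D s0) as HDs.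
  destruct (Rpower_small s (eta / Rpower D s0)) as [e1 [He1 Hsm]];
    [exact Hs|now apply Rdiv_lt_0_compat|].
  exists e1, (Rpower eta (/ s0) / D). split; [exact He1|].
  split; [apply Rdiv_lt_0_compat; [apply Rpower_pos|exact HD]|].
  intros eps T He HT HTle. specialize (Hsm eps He). pose proof (Rpower_pos eps s).
  destruct (Rle_dec T 1) as [H1|H1].
  - apply Rle_trans with (eta / Rpower D s0 * Rpower D s0); [|right; field; lra].
    apply Rmult_le_compat; [lra|left; apply Rpower_pos|exact Hsm|].
    apply Rle_Rpower_l; [lra|]. unfold D; lra.
  - apply Rle_trans with (Rpower eps s * Rpower (Rpower eta (/ s0) * Rpower eps (- s / s0)) s0).
    + apply Rmult_le_compat_l; [lra|]. apply Rle_Rpower_l; [lra|]. split; [lra|].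
      apply Rle_trans with (D * T); [unfold D; nra|].
      apply Rle_trans with (D * (Rpower eta (/ s0) / D * Rpower eps (- s / s0))).
      * apply Rmult_le_compat_l; lra.
      * right; field; lra.
    + rewrite Rpower_mult_base, !Rpower_mult by apply Rpower_pos.
      replace (/ s0 * s0) with 1 by (field; lra). replace (- s / s0 * s0) with (- s) by (field; lra).
      rewrite Rpower_1, Rpower_Ropp by lra. right; field; lra.
Qed.

(** With [be = max (p, - b)], [al = max (1 + a, 0)] and [q = be - 1], both
    smallness conditions reduce to the single one that [mu Th^(sg / p)] be
    small: the first since [1 - al <= sg / p], the second by raising it to the
    power [p].  The product is [eps^(p-1) Th^s0] by the choice of [lam], so the
    two polynomial lifespans are one. *)
Lemma polynomial_regime (p a b r : R) (f g : R -> R) (s0 : R) :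
  1 < p -> 1 <= r -> C0k 2 f -> C0k 1 g ->
  included (supp f) (fun x => Rabs x <= r) ->
  included (supp g) (fun x => Rabs x <= r) ->
  s0 = Rmax p (- b) / p - (1 + a) -> 0 < s0 ->
  exists eps1 c, 0 < eps1 /\ 0 < c /\ forall eps T, 0 < eps <= eps1 -> 0 < T ->
    T <= c * Rpower eps (- (p - 1) / s0) ->
    exists u, classical_solution p a b (fun x => eps * f x) (fun x => eps * g x) T u.
Proof.
  intros Hp Hr Hf Hg Hsf Hsgr Es0 Hs0.
  set (be := Rmax p (- b)) in *.
  assert (Hbe1 : p <= be) by apply Rmax_l. assert (Hbe2 : - b <= be) by apply Rmax_r.
  set (al := Rmax (1 + a) 0).
  assert (Hal : 0 <= al) by apply Rmax_r. assert (Hal1 : 1 + a <= al) by apply Rmax_l.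
  assert (Hbep : be = p * (s0 + (1 + a))) by (rewrite Es0; field; lra).
  assert (Hal_cases : al = 1 + a \/ al = 0) by (unfold al, Rmax; destruct Rle_dec; tauto).
  set (sg := be - 1 + 1 - p * al). set (tau := sg / p).
  assert (Hsg : 0 < sg).
  { unfold sg. destruct Hal_cases as [-> | ->]; [rewrite Hbep; nra|lra]. }
  assert (Htau : 0 < tau) by (apply Rdiv_lt_0_compat; lra).
  assert (Htau1 : 1 - al <= tau).
  { unfold tau. apply Rle_div_r; [lra|]. unfold sg. nra. }
  assert (Hq : (p - 1) * al <= be - 1).
  { destruct Hal_cases as [E | E]; [|rewrite E; lra].
    destruct (Rle_dec al 1); [nra|]. assert (p * (s0 + (1 + a)) >= p * al) by (rewrite E; nra). nra. }
  destruct (solvable p a b r f g al (be - 1)) as [dl [Hdl Hsol]]; try assumption.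
  set (eta := Rmin 1 (Rmin (dl * tau) (dl * sg))).
  assert (Heta : 0 < eta) by (repeat apply Rmin_pos; try apply Rmult_lt_0_compat; lra).
  assert (Heta1 : eta <= 1) by apply Rmin_l.
  assert (Heta2 : eta <= dl * tau) by (eapply Rle_trans; [apply Rmin_r|apply Rmin_l]).
  assert (Heta3 : eta <= dl * sg) by (eapply Rle_trans; [apply Rmin_r|apply Rmin_r]).
  destruct (polynomial_time (p - 1) s0 eta r) as (e1 & c & He1 & Hc & Ht); try assumption; [lra|].
  exists (Rmin e1 dl), c. split; [now apply Rmin_pos|]. split; [exact Hc|].
  intros eps T He HT HTle.
  assert (He' : 0 < eps <= e1) by (split; [lra|]; eapply Rle_trans; [apply He|apply Rmin_l]).
  assert (He'' : 0 < eps <= dl) by (split; [lra|]; eapply Rle_trans; [apply He|apply Rmin_r]).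
  specialize (Ht eps T He' HT HTle).
  set (Th := 2 * T + 2 * r + 2) in *. assert (HTh : 1 <= Th) by (unfold Th; lra).
  set (lam := Rpower Th (al - (1 + a))).
  assert (Hmu0 : 0 < lam * Rpower eps (p - 1)) by (apply Rmult_lt_0_compat; apply Rpower_pos).
  assert (Hrho : lam * Rpower eps (p - 1) * Rpower Th tau <= eta).
  { eapply Rle_trans; [|exact Ht]. right. unfold lam.
    replace s0 with (al - (1 + a) + tau) by (unfold tau, sg; rewrite Hbep; field; lra).
    rewrite Rpower_plus. ring. }
  pose proof (Rpower_ge1 Th tau HTh (Rlt_le _ _ Htau)) as HTt.
  assert (Hmu : lam * Rpower eps (p - 1) <= eta) by nra.
  assert (Hrho_p : Rpower (lam * Rpower eps (p - 1)) p * Rpower Th sg <= eta).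
  { replace sg with (tau * p) by (unfold tau; field; lra).
    rewrite <- (Rpower_mult Th tau p), <- Rpower_mult_base by (try apply Rpower_pos; exact Hmu0).
    eapply Rle_trans; [|exact Hrho]. apply Rpower_le_self; [|lra].
    split; [apply Rmult_lt_0_compat; [exact Hmu0|apply Rpower_pos]|lra]. }
  apply (Hsol eps lam T); try assumption; [apply Rpower_pos| | | |].
  - intros M m Hm HmM HM. fold Th in HM.
    assert (Rpower M (al - (1 + a)) <= lam) by (apply Rle_Rpower_l; lra).
    replace (- (1 + a)) with (al - (1 + a) + - al) by ring. rewrite Rpower_plus, Rmult_assoc.
    apply Rmult_le_compat; [left; apply Rpower_pos| |assumption|].
    + apply Rmult_le_pos; left; apply Rpower_pos.
    + apply Rmult_le_compat_l; [left; apply Rpower_pos|]. apply Rle_Rpower; lra.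
  - lra.
  - fold Th. apply Rle_trans with (lam * Rpower eps (p - 1) * (Rpower Th tau / tau)).
    + apply Rmult_le_compat_l; [lra|].
      apply Rle_trans with (pow_int tau Th); [now apply pow_int_mono|now apply pow_int_pos].
    + unfold Rdiv. rewrite <- Rmult_assoc. apply Rle_div_l; [exact Htau|lra].
  - fold Th sg. apply Rle_trans with (Rpower (lam * Rpower eps (p - 1)) p * (Rpower Th sg / sg)).
    + apply Rmult_le_compat_l; [left; apply Rpower_pos|now apply pow_int_pos].
    + unfold Rdiv. rewrite <- Rmult_assoc. apply Rle_div_l; [exact Hsg|lra].
Qed.

(** Here [al = 1] and [sigma = 0], and the logarithm that limits the time is the one
    collected along the cone. *)
Lemma log_regime_strip (p b r : R) (f g : R -> R) :
  1 < p -> 1 <= r -> C0k 2 f -> C0k 1 g ->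
  included (supp f) (fun x => Rabs x <= r) ->
  included (supp g) (fun x => Rabs x <= r) ->
  - p <= b ->
  exists eps1 c, 0 < eps1 /\ 0 < c /\ forall eps T, 0 < eps <= eps1 -> 0 < T ->
    T <= exp (c * Rpower eps (- (p - 1))) ->
    exists u, classical_solution p 0 b (fun x => eps * f x) (fun x => eps * g x) T u.
Proof.
  intros Hp Hr Hf Hg Hsf Hsgr Hb.
  destruct (solvable p 0 b r f g (1 + 0) (p - 1)) as [dl [Hdl Hsol]]; try assumption; try lra.
  destruct (exponential_time (p - 1) dl r) as (e1 & c & He1 & Hc & Ht); try assumption; [lra|].
  destruct (Rpower_small (p - 1) 1) as (e2 & He2 & Hsm); [lra|lra|].
  exists (Rmin (Rmin e1 e2) dl), c. split; [repeat apply Rmin_pos; lra|]. split; [exact Hc|].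
  intros eps T [He Hle] HT HTle.
  assert (h1 := Rmin_l (Rmin e1 e2) dl). assert (h2 := Rmin_r (Rmin e1 e2) dl).
  assert (h3 := Rmin_l e1 e2). assert (h4 := Rmin_r e1 e2).
  specialize (Ht eps T ltac:(lra) HT HTle). specialize (Hsm eps ltac:(lra)).
  pose proof (Rpower_pos eps (p - 1)) as Hmu.
  assert (Hln : 0 <= ln (2 * T + 2 * r + 2)) by (rewrite <- ln_1; apply ln_le; lra).
  apply (Hsol eps 1 T); [lra|lra|exact HT| | | |]; rewrite ?Rmult_1_l.
  - intros M m Hm HmM _. apply weight_exponent_le; lra.
  - exact Hsm.
  - replace (1 - (1 + 0)) with 0 by ring. rewrite pow_int_0 by lra. exact Ht.
  - replace (p - 1 + 1 - p * (1 + 0)) with 0 by ring. rewrite pow_int_0 by lra.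
    eapply Rle_trans; [|exact Ht]. apply Rmult_le_compat_r; [exact Hln|].
    apply Rpower_le_self; lra.
Qed.

(** Here [al > 1], so the integral along the cone is bounded, and the logarithm
    comes from the interior, [sigma = 0], with the factor
    [mu^p = eps^(p (p-1))]. *)
Lemma log_regime_interior (p a b r : R) (f g : R -> R) :
  1 < p -> 1 <= r -> C0k 2 f -> C0k 1 g ->
  included (supp f) (fun x => Rabs x <= r) ->
  included (supp g) (fun x => Rabs x <= r) ->
  0 < a -> p * (1 + a) + b = 0 ->
  exists eps1 c, 0 < eps1 /\ 0 < c /\ forall eps T, 0 < eps <= eps1 -> 0 < T ->
    T <= exp (c * Rpower eps (- (p * (p - 1)))) ->
    exists u, classical_solution p a b (fun x => eps * f x) (fun x => eps * g x) T u.
Proof.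
  intros Hp Hr Hf Hg Hsf Hsgr Ha Hab.
  destruct (solvable p a b r f g (1 + a) (p * (1 + a) - 1)) as [dl [Hdl Hsol]]; try assumption; try lra.
  destruct (exponential_time (p * (p - 1)) dl r) as (e1 & c & He1 & Hc & Ht); try assumption; [nra|].
  destruct (Rpower_small (p - 1) (Rmin 1 (dl * a))) as (e2 & He2 & Hsm);
    [lra|apply Rmin_pos; [lra|now apply Rmult_lt_0_compat]|].
  exists (Rmin (Rmin e1 e2) dl), c. split; [repeat apply Rmin_pos; lra|]. split; [exact Hc|].
  intros eps T [He Hle] HT HTle.
  assert (h1 := Rmin_l (Rmin e1 e2) dl). assert (h2 := Rmin_r (Rmin e1 e2) dl).
  assert (h3 := Rmin_l e1 e2). assert (h4 := Rmin_r e1 e2).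
  assert (h5 := Rmin_l 1 (dl * a)). assert (h6 := Rmin_r 1 (dl * a)).
  specialize (Ht eps T ltac:(lra) HT HTle). specialize (Hsm eps ltac:(lra)).
  pose proof (Rpower_pos eps (p - 1)) as Hmu.
  apply (Hsol eps 1 T); [lra|lra|exact HT| | | |]; rewrite ?Rmult_1_l.
  - intros M m Hm HmM _. apply weight_exponent_le; lra.
  - lra.
  - apply Rle_trans with (Rpower eps (p - 1) * / - - a).
    + apply Rmult_le_compat_l; [lra|]. replace (1 - (1 + a)) with (- a) by ring.
      apply pow_int_neg; lra.
    + rewrite Ropp_involutive. apply Rle_div_l; lra.
  - replace (p * (1 + a) - 1 + 1 - p * (1 + a)) with 0 by ring. rewrite pow_int_0 by lra.
    rewrite Rpower_mult. replace ((p - 1) * p) with (p * (p - 1)) by ring. exact Ht.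
Qed.

(** The exponent [q] is enlarged until [sigma >= - a], as the estimate of the
    source requires; [sigma] stays negative, so both integrals are bounded. *)
Lemma global_regime (p a b r : R) (f g : R -> R) :
  1 < p -> 1 <= r -> C0k 2 f -> C0k 1 g ->
  included (supp f) (fun x => Rabs x <= r) ->
  included (supp g) (fun x => Rabs x <= r) ->
  0 < a -> 0 < p * (1 + a) + b ->
  exists eps1, 0 < eps1 /\ forall eps T, 0 < eps <= eps1 -> 0 < T ->
    exists u, classical_solution p a b (fun x => eps * f x) (fun x => eps * g x) T u.
Proof.
  intros Hp Hr Hf Hg Hsf Hsgr Ha Hab.
  set (sg := Rmax (- a) (- b - p * (1 + a))).
  assert (Hsg1 : - a <= sg) by apply Rmax_l.
  assert (Hsg2 : - b - p * (1 + a) <= sg) by apply Rmax_r.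
  assert (Hsg : sg < 0) by (apply Rmax_lub_lt; lra).
  destruct (solvable p a b r f g (1 + a) (sg - 1 + p * (1 + a))) as [dl [Hdl Hsol]];
    try assumption; try lra.
  destruct (Rpower_small (p - 1) (Rmin 1 (Rmin (dl * a) (dl * - sg)))) as (e2 & He2 & Hsm);
    [lra|repeat apply Rmin_pos; try apply Rmult_lt_0_compat; lra|].
  exists (Rmin e2 dl). split; [apply Rmin_pos; lra|].
  intros eps T [He Hle] HT.
  assert (h1 := Rmin_l e2 dl). assert (h2 := Rmin_r e2 dl).
  assert (h3 := Rmin_l 1 (Rmin (dl * a) (dl * - sg))). assert (h4 := Rmin_r 1 (Rmin (dl * a) (dl * - sg))).
  assert (h5 := Rmin_l (dl * a) (dl * - sg)). assert (h6 := Rmin_r (dl * a) (dl * - sg)).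
  specialize (Hsm eps ltac:(lra)).
  pose proof (Rpower_pos eps (p - 1)) as Hmu.
  apply (Hsol eps 1 T); [lra|lra|exact HT| | | |]; rewrite ?Rmult_1_l.
  - intros M m Hm HmM _. apply weight_exponent_le; lra.
  - lra.
  - apply Rle_trans with (Rpower eps (p - 1) * / - - a).
    + apply Rmult_le_compat_l; [lra|]. replace (1 - (1 + a)) with (- a) by ring.
      apply pow_int_neg; lra.
    + rewrite Ropp_involutive. apply Rle_div_l; lra.
  - replace (sg - 1 + p * (1 + a) + 1 - p * (1 + a)) with sg by ring.
    apply Rle_trans with (Rpower eps (p - 1) * / - sg).
    + apply Rmult_le_compat; [left; apply Rpower_pos|apply pow_int_ge0; lra| |apply pow_int_neg; lra].
      apply Rpower_le_self; lra.
    + apply Rle_div_l; lra.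
Qed.

Theorem theorem2p1 (p a b r : R) (f g : R -> R)
    (hp : 1 < p) (hr : 1 <= r)
    (hf : C0k 2 f) (hg : C0k 1 g)
    (hsf : included (supp f) (fun x => Rabs x <= r))
    (hsg : included (supp g) (fun x => Rabs x <= r)) :
  exists eps1 c : R, 0 < eps1 /\ 0 < c /\
    forall eps : R, 0 < eps <= eps1 ->
    forall T : R, 0 < T -> admissible_time p a b c eps T ->
    exists u : R -> R -> R,
      classical_solution p a b (fun x => eps * f x) (fun x => eps * g x) T u.
Proof.
  assert (Hpoly3 : a < 0 -> - p <= b -> - a = Rmax p (- b) / p - (1 + a)).
  { intros Ha Hb. rewrite Rmax_left by lra. field. lra. }
  assert (Hpoly4 : b < - p ->
     (- p * (1 + a) - b) / p = Rmax p (- b) / p - (1 + a)).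
  { intros Hb. rewrite Rmax_right by lra. field. lra. }
  assert (Hcases : (a = 0 /\ - p <= b) \/ (0 < a /\ p * (1 + a) + b = 0) \/ (a < 0 /\ - p <= b)
     \/ (p * (1 + a) + b < 0 /\ b < - p) \/ (0 < a /\ 0 < p * (1 + a) + b)).
  { destruct (Rtotal_order (p * (1 + a) + b) 0) as [H|[H|H]];
      destruct (Rtotal_order a 0) as [H'|[H'|H']]; destruct (Rle_dec (- p) b); try lra; nra. }
  destruct Hcases as [[Ha Hb]|[[Ha Hab]|[[Ha Hb]|[[Hab Hb]|[Ha Hab]]]]].
  - subst a. destruct (log_regime_strip p b r f g) as (e1 & c & He1 & Hc & H); try assumption.
    exists e1, c. split; [exact He1|]. split; [exact Hc|]. intros eps He T HT Hadm.
    apply (H eps T He HT). destruct Hadm as [D|[D|[D|[D|D]]]]; lra.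
  - destruct (log_regime_interior p a b r f g) as (e1 & c & He1 & Hc & H); try assumption.
    exists e1, c. split; [exact He1|]. split; [exact Hc|]. intros eps He T HT Hadm.
    apply (H eps T He HT). destruct Hadm as [D|[D|[D|[D|D]]]]; lra.
  - destruct (polynomial_regime p a b r f g (- a)) as (e1 & c & He1 & Hc & H); try assumption;
      [now apply Hpoly3|lra|].
    exists e1, c. split; [exact He1|]. split; [exact Hc|]. intros eps He T HT Hadm.
    apply (H eps T He HT). destruct Hadm as [D|[D|[D|[D|D]]]]; lra.
  - destruct (polynomial_regime p a b r f g ((- p * (1 + a) - b) / p)) as (e1 & c & He1 & Hc & H);
      try assumption; [now apply Hpoly4|apply Rdiv_lt_0_compat; lra|].
    exists e1, c. split; [exact He1|]. split; [exact Hc|]. intros eps He T HT Hadm.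
    apply (H eps T He HT).
    replace (- (p - 1) / ((- p * (1 + a) - b) / p)) with (- (p * (p - 1)) / (- p * (1 + a) - b))
      by (field; lra).
    destruct Hadm as [D|[D|[D|[D|D]]]]; lra.
  - destruct (global_regime p a b r f g) as (e1 & He1 & H); try assumption.
    exists e1, 1. split; [exact He1|]. split; [lra|]. intros eps He T HT _. now apply H.
Qed.
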